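(* Let $K$ be a field, $S=K[x_1,\ldots,x_n]$, and let $I=I_{d;a_1,\ldots,a_n}\subset S$ be an ideal of Veronese type satisfying $$d<\sum_{i=1}^n a_i,\qquad d>1,\qquad a_1,\ldots,a_n\geq1.$$ Then: (a) $\operatorname{depth} S/I=\max\{0,\,d+n-1-\sum_{i=1}^n a_i\}$; (b) $\operatorname{depth} S/I^k=\max\{0,\,kd+n-1-\sum_{i=1}^n ka_i\}$; (c) $\operatorname{dstab}(I)=\left\lceil\dfrac{n-1}{\sum_{i=1}^n a_i-d}\right\rceil$. In particular, $\operatorname{astab}(I)=\operatorname{dstab}(I)$, $\lim_{k\to\infty}\operatorname{depth} S/I^k=0$ and $\ell(I)=n$.
   Context: For a positive integer $d$ and non-negative integers $a_1,\ldots,a_n$ with $a_1+\cdots+a_n\ge d$, the ideal of Veronese type $I_{d;a_1,\ldots,a_n}\subset S$ is the monomial ideal generated by all monomials $x_1^{u(1)}\cdots x_n^{u(n)}$ with $u(1)+\cdots+u(n)=d$ and $0\le u(i)\le a_i$ for all $i$. In (b), $k$ is any positive integer. Depth is with respect to the graded maximal ideal $\mathfrak m=(x_1,\ldots,x_n)$. $\operatorname{dstab}(I)$, the index of depth stability of $I$, is the smallest integer $k_0$ such that $\operatorname{depth} S/I^k=\operatorname{depth} S/I^{k_0}$ for all $k\ge k_0$. $\operatorname{astab}(I)$, the index of stability of $I$, is the smallest integer $k_1$ such that $\operatorname{Ass}(I^k)=\operatorname{Ass}(I^{k_1})$ for all $k\ge k_1$, where $\operatorname{Ass}(J)$ is the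 set of associated prime ideals of $S/J$. The analytic spread $\ell(I)$ is the Krull dimension of the fiber ring $\mathcal R(I)/\mathfrak m\mathcal R(I)$, where $\mathcal R(I)=\bigoplus_{k\ge0}I^kt^k$ is the Rees algebra of $I$.
   Formalization: Formula (c) for dstab(I) is claimed only for n ≥ 2: for n = 1 the ceiling is 0 while dstab(I) = 1 (e.g. I = (x^2), a_1 = 3); all other claims, including astab(I) = dstab(I), are stated for every n. *)

(* Defs.v *)
From HB Require Import structures.
From mathcomp Require Import all_boot all_order all_algebra ring_quotient.
From mathcomp Require Import boolp classical_sets filter.
From mathcomp Require Import topology_structure nat_topology.
From mathcomp Require Import mpoly.

Set Implicit Arguments.
Unset Strict Implicit.
Unset Printing Implicit Defensive.

Import GRing.Theory.

Local Open Scope ring_scope.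

(* Ideals are {pred R}.  Since arbitrary propositions are reflected into bool
   by `[< _ >], quantifying over {pred R} ranges over all subsets of R.       *)

Section Ideals.
Variable R : comNzRingType.
Implicit Types (G I J P m : {pred R}) (s : seq R).

Definition ideal_gen G : {pred R} := fun x =>
  `[< exists2 s : seq (R * R), {in s, forall q, q.2 \in G}
        & x = \sum_(q <- s) q.1 * q.2 >].

Definition ideal_add I J : {pred R} := fun x =>
  `[< exists u v, [/\ u \in I, v \in J & x = u + v] >].

Definition ideal_mul I J : {pred R} :=
  ideal_gen (fun x => `[< exists u v, [/\ u \in I, v \in J & x = u * v] >]).

Fixpoint ideal_exp I k : {pred R} :=
  if k is k'.+1 then ideal_mul I (ideal_exp I k') else predT.

(* idealr_closed includes 1 \notin P *)
Definition is_prime_ideal P : Prop := idealr_closed P /\ prime_idealr_closed P.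

(* P \in Ass(R/J): P is prime and P = Ann(f mod J) for some f *)
Definition is_assoc_prime J P : Prop :=
  is_prime_ideal P /\ exists f, forall g, (g \in P) = (g * f \in J).

(* s = f_1, ..., f_r is a regular sequence on the R-module R/J: f_(i+1) is a
   nonzerodivisor on R/(J + (f_1, ..., f_i)), and R/(J + (s)) != 0.           *)
Definition regular_seq J s : Prop :=
  (forall i g, (i < size s)%N ->
     s`_i * g \in ideal_add J (ideal_gen (mem (take i s))) ->
     g \in ideal_add J (ideal_gen (mem (take i s))))
  /\ 1 \notin ideal_add J (ideal_gen (mem s)).

(* depth of R/J with respect to m; the zero module has no depth here *)
Definition is_depth m J (r : nat) : Prop :=
  (exists s, [/\ size s = r, {subset s <= m} & regular_seq J s]) /\
  (forall s, {subset s <= m} -> regular_seq J s -> (size s <= r)%N).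

Definition is_least (Q : nat -> Prop) (r : nat) : Prop :=
  Q r /\ forall k, Q k -> (r <= k)%N.

Definition is_dstab m I : nat -> Prop :=
  is_least (fun k0 => (0 < k0)%N /\ forall k, (k0 <= k)%N ->
    exists r, is_depth m (ideal_exp I k) r /\ is_depth m (ideal_exp I k0) r).

Definition is_astab I : nat -> Prop :=
  is_least (fun k1 => (0 < k1)%N /\ forall k, (k1 <= k)%N ->
    forall P, is_assoc_prime (ideal_exp I k) P <->
              is_assoc_prime (ideal_exp I k1) P).

(* c 0, ..., c r is a strictly increasing chain of prime ideals *)
Definition prime_chain (c : nat -> {pred R}) (r : nat) : Prop :=
  (forall i, (i <= r)%N -> is_prime_ideal (c i)) /\
  (forall i, (i < r)%N -> {subset c i <= c i.+1} /\ ~ {subset c i.+1 <= c i}).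

Definition is_krull_dim (r : nat) : Prop :=
  (exists c, prime_chain c r) /\ (forall c k, prime_chain c k -> (k <= r)%N).

Lemma ideal_gen_sub G x : x \in G -> x \in ideal_gen G.
Proof.
move=> Gx; apply/asboolP; exists [:: (1, x)].
  by move=> q; rewrite inE => /eqP ->.
by rewrite big_seq1 mul1r.
Qed.

Lemma ideal_gen0 G : 0 \in ideal_gen G.
Proof. by apply/asboolP; exists [::]; rewrite ?big_nil. Qed.

Lemma ideal_genD G x y :
  x \in ideal_gen G -> y \in ideal_gen G -> x + y \in ideal_gen G.
Proof.
move=> /asboolP[s Gs ->] /asboolP[t Gt ->]; apply/asboolP; exists (s ++ t).
  by move=> q; rewrite mem_cat => /orP[/Gs|/Gt].
by rewrite big_cat.
Qed.

Lemma ideal_genM G a x : x \in ideal_gen G -> a * x \in ideal_gen G.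
Proof.
move=> /asboolP[s Gs ->]; apply/asboolP.
exists [seq (a * q.1, q.2) | q <- s].
  by move=> _ /mapP[q qs ->]; exact: (Gs q).
by rewrite big_map mulr_sumr; apply: eq_bigr => q _; rewrite mulrA.
Qed.

Lemma ideal_exp0 I k : 0 \in ideal_exp I k.
Proof. by case: k => // k; apply: ideal_gen0. Qed.

Lemma ideal_expD I k x y :
  x \in ideal_exp I k -> y \in ideal_exp I k -> x + y \in ideal_exp I k.
Proof. by case: k => // k; apply: ideal_genD. Qed.

Lemma ideal_expM I k a x : x \in ideal_exp I k -> a * x \in ideal_exp I k.
Proof. by case: k => // k; apply: ideal_genM. Qed.

Lemma ideal_exp_sum I k (T : eqType) (s : seq T) (F : T -> R) :
  {in s, forall q, F q \in ideal_exp I k} ->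
  \sum_(q <- s) F q \in ideal_exp I k.
Proof.
move=> sF; rewrite big_seq; apply: (big_ind (fun x => x \in ideal_exp I k)) => //.
- exact: ideal_exp0.
- by move=> x y; apply: ideal_expD.
Qed.

Lemma ideal_expMM I j k x y :
  x \in ideal_exp I j -> y \in ideal_exp I k -> x * y \in ideal_exp I (j + k).
Proof.
elim: j x => [|j IH] x; first by move=> _; apply: ideal_expM.
move=> /asboolP[s Gs ->] yk; rewrite mulr_suml; apply: ideal_exp_sum => q qs.
rewrite -mulrA; apply: ideal_expM.
have /asboolP[u [v [uI vj ->]]] := Gs _ qs.
apply: ideal_gen_sub; apply/asboolP; exists u, (v * y).
by split=> //; [apply: IH | rewrite mulrA].
Qed.

(* the Rees algebra, as the subring \bigoplus_k I^k t^k of R[t] *)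
Definition rees_pred I : {pred {poly R}} := fun p =>
  `[< forall k, p`_k \in ideal_exp I k >].

Lemma rees_pred_subring I : subring_closed (rees_pred I).
Proof.
split.
- by apply/asboolP => -[|k] //; rewrite coef1; apply: ideal_exp0.
- move=> p q /asboolP hp /asboolP hq; apply/asboolP => k.
  by rewrite coefB -mulN1r; apply: ideal_expD => //; apply: ideal_expM.
- move=> p q /asboolP hp /asboolP hq; apply/asboolP => k.
  rewrite coefM; apply: ideal_exp_sum => i _.
  by have := ideal_expMM (hp i) (hq (k - i)%N); rewrite subnKC // -ltnS.
Qed.

HB.instance Definition _ I :=
  GRing.isSubringClosed.Build {poly R} (rees_pred I) (rees_pred_subring I).

Record rees I := Rees { rees_val :> {poly R}; _ : rees_val \in rees_pred I }.

HB.instance Definition _ I := [isSub for @rees_val I].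
HB.instance Definition _ I := [Choice of rees I by <:].
HB.instance Definition _ I := [SubChoice_isSubComNzRing of rees I by <:].

End Ideals.

Section PolynomialIdeals.
Variables (K : fieldType) (n : nat).
Local Notation S := {mpoly K[n]}.

Definition max_ideal : {pred S} :=
  ideal_gen (fun p : S => [exists i : 'I_n, p == 'X_i]).

Definition veronese_ideal (d : nat) (a : 'I_n -> nat) : {pred S} :=
  ideal_gen (fun p : S =>
    `[< exists u : 'X_{1..n},
          [/\ mdeg u = d, forall i, (u i <= a i)%N & p = 'X_[u]] >]).

(* the extended ideal m R(I) of the Rees algebra R(I) *)
Definition fiber_ideal (I : {pred S}) : {pred rees I} :=
  ideal_gen (fun z : rees I =>
    `[< exists2 f : S, f \in max_ideal & rees_val z = f%:P >]).

Arguments fiber_ideal : clear implicits.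

Lemma max_ideal_eval0 (f : S) : f \in max_ideal -> f.@[fun=> 0] = 0.
Proof.
move=> /asboolP[s Gs ->]; rewrite rmorph_sum big_seq big1 //= => q /Gs.
by move=> /existsP[i /eqP ->]; rewrite mevalM mevalXU mulr0.
Qed.

Lemma fiber_ideal_closed I : idealr_closed (fiber_ideal I).
Proof.
split; first exact: ideal_gen0; last first.
  by move=> a x y xI yI; apply: ideal_genD => //; apply: ideal_genM.
apply/negP => /asboolP[s Gs /(congr1 \val)]; rewrite rmorph1 rmorph_sum.
move=> /(congr1 (fun p : {poly S} => p`_0)); rewrite coef1 coef_sum.
move=> /(congr1 (meval (fun=> 0 : K))); rewrite rmorph1 rmorph_sum.
rewrite big_seq big1 => [/eqP|q /Gs /asboolP[f fm fE]].
  by rewrite oner_eq0.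
by rewrite rmorphM /= fE coefMC mevalM (max_ideal_eval0 fm) mulr0.
Qed.

HB.instance Definition _ I :=
  isIdealr.Build (rees I) (fiber_ideal I) (fiber_ideal_closed I).

Definition fiber_ring (I : {pred S}) : comNzRingType :=
  {ideal_quot (fiber_ideal I)}.

Definition is_analytic_spread (I : {pred S}) : nat -> Prop :=
  is_krull_dim (fiber_ring I).

End PolynomialIdeals.

Arguments max_ideal : clear implicits.
Arguments veronese_ideal : clear implicits.

(* Main.v *)
(** Monomials: x^v lies in I^k iff sum_i min(v_i, k a_i) >= k d.  Put b = k a,
    D = k d and s = sum b - D; the depth of S/I^k is max(0, n - 1 - s).

    Lower bound.  Splitting off one variable at a time by L : x_i and L + x_i
    filters S/I^k with factors S/P_A, where P_A is generated by the variables in A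
    and 0 < |A| <= s + 1.  The elementary symmetric polynomials e_r, ..., e_1
    (r = n - 1 - s) form a regular sequence on every S/P_A with |A| <= n - r, hence
    on S/I^k.  They are used instead of linear forms because K may be finite.

    Upper bound.  In the Koszul complex of x_1, ..., x_n over S/I^k, the chain
    x^u e_sigma, where |sigma| = min(s + 1, n), |u| = D - 1, u <= b and u_i < b_i
    for i in sigma, is a cycle, and not a boundary for degree reasons.  Each element
    of a regular sequence turns a nontrivial class into one of degree one higher, so
    that no regular sequence is longer than n - |sigma|.

    Associated primes.  P_A is associated to I^k iff sum_(i notin A) a_i < d and
    |A| <= k (sum a - d) + 1; in particular the maximal ideal is the last prime to
    appear.

    Analytic spread.  Taking lowest-degree parts embeds the fiber ring in S.  The
    ideals x_1 = ... = x_j = 1 cut out a chain of n + 1 distinct primes.  A longer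
    chain would give n + 1 elements whose monomials are linearly independent, while
    counting dimensions shows that n + 1 polynomials in n variables are dependent. *)

Require Import Defs.
From HB Require Import structures.
From mathcomp Require Import all_boot all_order all_algebra.
From mathcomp Require Import boolp classical_sets filter.
From mathcomp Require Import topology_structure nat_topology.
From mathcomp Require Import mpoly.
From mathcomp Require Import ring_quotient generic_quotient zify ring.

Import GRing.Theory Num.Theory.

Local Open Scope classical_set_scope.
Local Open Scope ring_scope.

Set Implicit Arguments.
Unset Strict Implicit.
Unset Printing Implicit Defensive.

(** * Weakly regular sequences *)

Section WeaklyRegularSequences.
Variable R : comNzRingType.
Implicit Types (L J P m : {pred R}) (x y g p : R) (ys : seq R).

(** Unlike [idealr_closed], this admits the unit ideal, which occurs below as a colon ideal and as a
    zeroth power. *)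
Definition is_ideal L : Prop :=
  [/\ 0 \in L, {in L &, forall u v, u + v \in L}
    & forall a u, u \in L -> a * u \in L].

Lemma is_idealB L u v : is_ideal L -> u \in L -> v \in L -> u - v \in L.
Proof. by case=> _ LD LM uL vL; rewrite -mulN1r; apply: LD => //; apply: LM. Qed.

Lemma is_ideal_sum L (T : eqType) (s : seq T) (F : T -> R) :
  is_ideal L -> {in s, forall q, F q \in L} -> \sum_(q <- s) F q \in L.
Proof.
move=> [L0 LD _] sF; rewrite big_seq.
exact: (big_ind (fun x => x \in L)).
Qed.

Lemma ideal_gen_is_ideal L : is_ideal (ideal_gen L).
Proof.
split; first exact: ideal_gen0; first exact: ideal_genD.
exact: ideal_genM.
Qed.

Lemma ideal_gen_min L J : is_ideal J -> {subset L <= J} ->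
  {subset ideal_gen L <= J}.
Proof.
move=> JI LJ _ /asboolP[s Ls ->]; apply: is_ideal_sum => // q qs.
by case: JI => _ _; apply; apply: LJ; apply: Ls.
Qed.

Definition colon L x : {pred R} := fun p => x * p \in L.

(** This is L + (y), with a single cofactor as witness; folding it along a list replaces the sum of
    [L] with a generated ideal. *)
Definition adjoin L y : {pred R} := fun p => `[< exists g, p - g * y \in L >].

Lemma adjoinP L y p : reflect (exists g, p - g * y \in L) (p \in adjoin L y).
Proof. exact: asboolP. Qed.

Lemma adjoin_is_ideal L y : is_ideal L -> is_ideal (adjoin L y).
Proof.
move=> [L0 LD LM]; split.
- by apply/adjoinP; exists 0; rewrite mul0r subr0.
- move=> u v /adjoinP[g gL] /adjoinP[h hL]; apply/adjoinP; exists (g + h).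
  have -> : u + v - (g + h) * y = (u - g * y) + (v - h * y) by ring.
  exact: LD.
- move=> a u /adjoinP[g gL]; apply/adjoinP; exists (a * g).
  have -> : a * u - a * g * y = a * (u - g * y) by ring.
  exact: LM.
Qed.

Lemma sub_adjoin L y : {subset L <= adjoin L y}.
Proof. by move=> p pL; apply/adjoinP; exists 0; rewrite mul0r subr0. Qed.

Lemma mem_adjoin L y g : is_ideal L -> g * y \in adjoin L y.
Proof. by move=> [L0 _ _]; apply/adjoinP; exists g; rewrite subrr. Qed.

Lemma eq_adjoin L L' y : L =i L' -> adjoin L y =i adjoin L' y.
Proof.
move=> LL p; apply/adjoinP/adjoinP=> -[g gL]; exists g; first by rewrite -LL.
by rewrite LL.
Qed.

Lemma adjoin_congr L y y' : is_ideal L -> y - y' \in L ->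
  adjoin L y =i adjoin L y'.
Proof.
move=> LI yy p; have [_ LD LM] := LI; apply/adjoinP/adjoinP=> -[g gL]; exists g.
  have -> : p - g * y' = (p - g * y) + g * (y - y') by ring.
  by apply: LD => //; apply: LM.
have -> : p - g * y = (p - g * y') - g * (y - y') by ring.
by apply: is_idealB => //; apply: LM.
Qed.

Lemma adjoinC L x y : adjoin (adjoin L x) y =i adjoin (adjoin L y) x.
Proof.
move=> p; apply/adjoinP/adjoinP=> -[g /adjoinP[h hL]]; exists h; apply/adjoinP;
  by exists g; rewrite addrAC.
Qed.

Lemma foldl_adjoin_is_ideal L ys : is_ideal L -> is_ideal (foldl adjoin L ys).
Proof. by elim: ys L => //= y ys IH L LI; apply/IH/adjoin_is_ideal. Qed.

Lemma sub_foldl_adjoin L ys : {subset L <= foldl adjoin L ys}.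
Proof. by elim: ys L => [|y ys IH] L p pL //=; apply/IH/sub_adjoin. Qed.

Lemma mem_foldl_adjoin L ys y : is_ideal L -> y \in ys -> y \in foldl adjoin L ys.
Proof.
elim: ys L => //= z ys IH L LI; rewrite inE => /orP[/eqP->|yys].
  by apply: sub_foldl_adjoin; rewrite -{1}[z]mul1r; apply: mem_adjoin.
by apply: IH => //; apply: adjoin_is_ideal.
Qed.

Lemma foldl_adjoin_min L ys J : is_ideal J -> {subset L <= J} ->
  {subset ys <= J} -> {subset foldl adjoin L ys <= J}.
Proof.
move=> JI; elim: ys L => //= y ys IH L LJ ysJ; apply: IH; last first.
  by move=> z zys; apply: ysJ; rewrite inE zys orbT.
move=> p /adjoinP[g gL]; have [_ JD JM] := JI; rewrite -(subrK (g * y) p).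
by apply: JD; [apply: LJ | apply/JM/ysJ; rewrite inE eqxx].
Qed.

(** Each side is the least ideal containing [L] and the entries of [ys]; this ties the recursive
    form to the definition of a regular sequence. *)
Lemma ideal_add_gen L ys : is_ideal L ->
  ideal_add L (ideal_gen (mem ys)) =i foldl adjoin L ys.
Proof.
move=> LI p; have [_ FD _] := foldl_adjoin_is_ideal ys LI.
apply/idP/idP.
  move=> /asboolP[u [v [uL vG ->]]]; apply: FD; first exact: sub_foldl_adjoin.
  apply: ideal_gen_min vG; first exact: foldl_adjoin_is_ideal.
  by move=> y; apply: mem_foldl_adjoin.
elim: ys {FD} p => [|y ys IH] p.
  move=> pL; apply/asboolP; exists p, 0; split=> //; last by rewrite addr0.
  exact: ideal_gen0.
apply: foldl_adjoin_min.
- have [L0 LD LM] := LI; split.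
  + apply/asboolP; exists 0, 0; split=> //; last by rewrite addr0.
    exact: ideal_gen0.
  + move=> u v /asboolP[u1 [u2 [u1L u2G ->]]] /asboolP[v1 [v2 [v1L v2G ->]]].
    apply/asboolP; exists (u1 + v1), (u2 + v2); split; first exact: LD.
      exact: ideal_genD.
    by rewrite addrACA.
  + move=> a u /asboolP[u1 [u2 [u1L u2G ->]]].
    apply/asboolP; exists (a * u1), (a * u2); split; first exact: LM.
      exact: ideal_genM.
    by rewrite mulrDr.
- move=> u uL; apply/asboolP; exists u, 0; split=> //; last by rewrite addr0.
  exact: ideal_gen0.
- move=> u uys; apply/asboolP; exists 0, u; split; first by case: LI.
    exact: ideal_gen_sub.
  by rewrite add0r.
Qed.

(** Properness is dropped so that zero factors of a filtration cause no trouble. The recursion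
    changes the base ideal, so that inductions can take the head of the sequence while [L]
    varies. *)
Fixpoint weakly_regular L ys : Prop :=
  if ys is y :: ys' then
    (forall g, y * g \in L -> g \in L) /\ weakly_regular (adjoin L y) ys'
  else True.

Lemma eq_weakly_regular L L' ys : L =i L' ->
  weakly_regular L ys -> weakly_regular L' ys.
Proof.
elim: ys L L' => //= y ys IH L L' LL [yL ysL]; split.
  by move=> g; rewrite -!LL; apply: yL.
by apply: IH ysL; apply: eq_adjoin.
Qed.

Lemma weakly_regular_unit L ys : (forall p, p \in L) -> weakly_regular L ys.
Proof.
by elim: ys L => //= y ys IH L LT; split=> //; apply: IH => p; apply/sub_adjoin.
Qed.

Lemma regular_seqP J ys : is_ideal J ->
  regular_seq J ys <-> weakly_regular J ys /\ 1 \notin foldl adjoin J ys.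
Proof.
move=> JI; rewrite /regular_seq ideal_add_gen //.
have -> : (forall i g, (i < size ys)%N ->
     ys`_i * g \in ideal_add J (ideal_gen (mem (take i ys))) ->
     g \in ideal_add J (ideal_gen (mem (take i ys)))) <->
  forall i g, (i < size ys)%N ->
     ys`_i * g \in foldl adjoin J (take i ys) -> g \in foldl adjoin J (take i ys).
  by split=> H i g; have := H i g; rewrite !ideal_add_gen.
suff -> : (forall i g, (i < size ys)%N ->
     ys`_i * g \in foldl adjoin J (take i ys) ->
     g \in foldl adjoin J (take i ys)) <-> weakly_regular J ys by [].
elim: ys J {JI} => //= y ys IH J; split=> [H|[yJ ysJ]].
  by split=> [g|]; [apply: (H 0%N) | apply/IH => i g; apply: (H i.+1)].
by case=> [|i] g /= isz; [apply: yJ | apply: (IH _).2].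
Qed.

(* Multiplication by x gives an exact sequence
   0 -> R/(L : x) -> R/L -> R/(L + x) -> 0, which stays exact modulo y because y is
   regular on its last term. *)
Lemma weakly_regular_colon_adjoin L x ys : is_ideal L ->
  weakly_regular (colon L x) ys -> weakly_regular (adjoin L x) ys ->
  weakly_regular L ys.
Proof.
elim: ys L => //= y ys IH L LI [yC ysC] [yA ysA]; have [L0 LD LM] := LI.
split=> [g ygL|].
  have /adjoinP[h hL] := yA _ (sub_adjoin x ygL).
  suff hC : h \in colon L x.
    by rewrite -(subrK (h * x) g); apply: LD => //; rewrite mulrC.
  apply: yC; have -> : (y * h \in colon L x) = (x * (y * h) \in L) by [].
  have -> : x * (y * h) = y * g - y * (g - h * x) by ring.
  by apply: is_idealB => //; apply: LM.
apply: IH; first exact: adjoin_is_ideal.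
  apply: eq_weakly_regular ysC => h.
  have -> : (h \in colon (adjoin L y) x) = (x * h \in adjoin L y) by [].
  apply/adjoinP/adjoinP=> -[g gL].
    exists (x * g); have -> : x * h - x * g * y = x * (h - g * y) by ring.
    exact: gL.
  have /adjoinP[g' g'L] : g \in adjoin L x.
    apply: yA; apply/adjoinP; exists h.
    have -> : y * g - h * x = -1 * (x * h - g * y) by ring.
    exact: LM.
  exists g'; have -> : (h - g' * y \in colon L x) = (x * (h - g' * y) \in L) by [].
  have -> : x * (h - g' * y) = (x * h - g * y) + y * (g - g' * x) by ring.
  by apply: LD => //; apply: LM.
by apply: eq_weakly_regular ysA; apply: adjoinC.
Qed.

End WeaklyRegularSequences.

(** * Monomial ideals *)

Section MonomialIdeals.
Variables (n : nat) (K : idomainType).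
Local Notation S := {mpoly K[n]}.
Local Notation mono := 'X_{1..n}.
Implicit Types (V : pred mono) (p q g y : S) (w v m : mono) (L : {pred S}).

(** The K-span of the monomials in [V]. It is an ideal when [V] is upward closed; other [V] serve to
    bound degrees from above. *)
Definition mideal V : {pred S} := fun p => all V (msupp p).

Lemma midealP V p : reflect {in msupp p, forall m, V m} (p \in mideal V).
Proof. exact: allP. Qed.

Definition upclosed V := forall m k, V m -> V (k + m)%MM.

Lemma mideal_is_ideal V : upclosed V -> is_ideal (mideal V).
Proof.
move=> Vup; split.
- by apply/midealP => m; rewrite mcoeff_msupp mcoeff0 eqxx.
- move=> p q /midealP pV /midealP qV; apply/midealP => m.
  by move/msuppD_le; rewrite mem_cat => /orP[/pV|/qV].
- move=> a p /midealP pV; apply/midealP => m /msuppM_le /allpairsP[[k l] /=].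
  by case=> _ /pV lV ->; apply: Vup.
Qed.

Lemma eq_mideal V V' : V =1 V' -> mideal V =i mideal V'.
Proof. by move=> VV p; apply: eq_all. Qed.

Lemma mideal_monomial V m : ('X_[m] \in mideal V) = V m.
Proof. by rewrite unfold_in /mideal msuppX /= andbT. Qed.

Lemma mideal_mulX V w p :
  ('X_[w] * p \in mideal V) = (p \in mideal (fun m => V (w + m)%MM)).
Proof.
rewrite mulrC !unfold_in /mideal (perm_all _ (msuppMX _ _)) all_map.
exact: eq_all.
Qed.

Lemma mem_ideal_monomials L p : is_ideal L ->
  {in msupp p, forall m, 'X_[m] \in L} -> p \in L.
Proof.
move=> LI pL; rewrite [p]mpolyE; apply: is_ideal_sum => // m mp.
by rewrite -mul_mpolyC; case: LI => _ _; apply; apply: pL.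
Qed.

Definition mpart V p : S := \sum_(m <- msupp p | V m) p@_m *: 'X_[m].

Lemma mcoeff_mpart V p m : (mpart V p)@_m = if V m then p@_m else 0.
Proof.
rewrite /mpart raddf_sum big_mkcond /=.
under eq_bigr do rewrite mcoeffZ mcoeffX.
have [mp|mp] := boolP (m \in msupp p); last first.
  rewrite (memN_msupp_eq0 mp) if_same big1_seq // => k /andP[_ kp].
  case: eqP kp mp => [->->//|]; by rewrite mulr0 if_same.
rewrite (bigD1_seq m) //= eqxx mulr1 big1 ?addr0 // => k /negPf->.
by rewrite mulr0 if_same.
Qed.

Lemma msupp_mpart V p m : (m \in msupp (mpart V p)) = V m && (m \in msupp p).
Proof. by rewrite !mcoeff_msupp mcoeff_mpart; case: ifP => // _; rewrite eqxx. Qed.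

Lemma sub_mpart V p : p - mpart V p = mpart (predC V) p.
Proof.
apply/mpolyP => m; rewrite mcoeffB !mcoeff_mpart /=.
by case: (V m); rewrite ?subrr ?subr0.
Qed.

Lemma adjoin_mideal V w : upclosed V ->
  adjoin (mideal V) 'X_[w] =i mideal (fun m => V m || (w <= m)%MM).
Proof.
move=> Vup p; apply/idP/idP.
  have WI : is_ideal (mideal (fun m => V m || (w <= m)%MM)).
    apply: mideal_is_ideal => m k /orP[Vm|wm]; first by rewrite Vup.
    by rewrite (lepm_trans wm) ?orbT // lem_addl.
  move=> /adjoinP[g /midealP gV]; rewrite -(subrK (g * 'X_[w]) p).
  case: WI => _ WD WM; apply: WD.
    by apply/midealP => m /gV ->.
  by apply: WM; rewrite mideal_monomial lepm_refl orbT.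
move=> /midealP pW; have VI := mideal_is_ideal Vup.
apply: mem_ideal_monomials => [|m /pW]; first exact: adjoin_is_ideal.
case/orP=> [Vm|wm]; first by apply: sub_adjoin; rewrite mideal_monomial.
by rewrite -(submK wm) mpolyXD; apply: mem_adjoin.
Qed.

End MonomialIdeals.

(** * Lower bound for the depth *)

Section GradedIdeals.
Variables (n : nat) (K : idomainType).
Local Notation S := {mpoly K[n]}.
Local Notation mono := 'X_{1..n}.
Local Notation hpart := (pihomog mdeg).
Implicit Types (V : pred mono) (p q g y : S) (w v m : mono) (L : {pred S}).

Definition graded L := forall p e, p \in L -> hpart e p \in L.

Lemma graded_mideal V : graded (mideal V).
Proof.
move=> p e /midealP pV; apply/midealP => m.
have -> : hpart e p = mpart [pred m | mdeg m == e] p by [].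
by rewrite msupp_mpart => /andP[_ /pV].
Qed.

(** The case split matters because [e - d] is 0 when e < d, and the degree 0 part of [g] would then
    wrongly appear. *)
Lemma pihomogM_homog d e g y : y \is d.-homog ->
  hpart e (g * y) = if (d <= e)%N then hpart (e - d) g * y else 0.
Proof.
move=> yd; rewrite [g]mpolyE mulr_suml !raddf_sum mulr_suml /=.
have -> (F : mono -> S) : (if (d <= e)%N then \sum_(m <- msupp g) F m else 0)
    = \sum_(m <- msupp g) (if (d <= e)%N then F m else 0).
  by case: ifP => // _; rewrite big1.
apply: eq_bigr => m _; rewrite -scalerAl !linearZ /= pihomogX.
have my : 'X_[m] * y \is (mdeg m + d).-homog.
  by apply: dhomogM => //; rewrite dhomogX.
case: (eqVneq (mdeg m + d)%N e) => [mde|mde].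
  rewrite -{1}mde pihomog_dE // -mde leq_addl addnK eqxx.
  by rewrite scalerAl.
rewrite (pihomog_ne0 mde my) scaler0; case: ifP => // de.
case: eqP => [mE|]; last by rewrite scaler0 mul0r.
by rewrite mE subnK ?eqxx in mde.
Qed.

Lemma graded_adjoin L y d : graded L -> y \is d.-homog -> graded (adjoin L y).
Proof.
move=> gL yd p e /adjoinP[g /(gL _ e)].
rewrite raddfB /= (pihomogM_homog _ _ yd) => pgL; apply/adjoinP.
move: pgL; case: ifP => _ pgL; first by exists (hpart (e - d) g).
by exists 0; rewrite mul0r.
Qed.

Lemma graded_mem L p : is_ideal L -> (forall e, hpart e p \in L) -> p \in L.
Proof.
move=> LI pL; rewrite (pihomog_partitionE (leqnn (mmeasure mdeg p))).
by rewrite -big_enum; apply: is_ideal_sum.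
Qed.

(** A Nakayama-type argument by degree: if y h is in L, then h = u x modulo L by regularity over L +
    (x); cancelling x puts y u in L, and u has smaller degree than h. *)
Lemma regular_of_quotient L x y d : is_ideal L -> graded L ->
  x \is 1.-homog -> y \is d.-homog -> (forall g, x * g \in L -> g \in L) ->
  (forall g, y * g \in adjoin L x -> g \in adjoin L x) ->
  forall g, y * g \in L -> g \in L.
Proof.
move=> LI gL x1 yd xreg yreg g ygL; have [_ LD LM] := LI.
suff H e h : h \is e.-homog -> y * h \in L -> h \in L.
  apply: graded_mem => // e; apply: (H e); first exact: pihomogP.
  have := gL _ (e + d)%N ygL.
  by rewrite mulrC (pihomogM_homog _ _ yd) leq_addl addnK mulrC.
elim: e h => [|e IH] h he yhL.
  have /adjoinP[u /(gL _ 0)] := yreg _ (sub_adjoin x yhL).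
  by rewrite raddfB /= (pihomogM_homog _ _ x1) subr0 pihomog_dE.
have /adjoinP[u /(gL _ e.+1)] := yreg _ (sub_adjoin x yhL).
rewrite raddfB /= (pihomogM_homog _ _ x1) subn1 /= pihomog_dE // => huL.
rewrite -(subrK (hpart e u * x) h); apply: LD => //.
rewrite mulrC; apply: (LM); apply: IH; first exact: pihomogP.
apply: xreg.
have -> : x * (y * hpart e u) = y * h - y * (h - hpart e u * x) by ring.
by apply: is_idealB => //; apply: LM.
Qed.

(** Besides lifting each regularity from L + (x) to L, [x] must be carried past every [y]: it stays
    regular on L + (y) because [y] is regular on L + (x). *)
Lemma weakly_regular_of_quotient L x ys : is_ideal L -> graded L ->
  x \is 1.-homog -> (forall g, x * g \in L -> g \in L) ->
  {in ys, forall y, exists d, y \is d.-homog} ->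
  weakly_regular (adjoin L x) ys -> weakly_regular L ys.
Proof.
move=> + + x1; elim: ys L => //= y ys IH L LI gL xreg ysh [yreg ysreg].
have [d yd] : exists d, y \is d.-homog by apply: ysh; rewrite inE eqxx.
have yregL := regular_of_quotient LI gL x1 yd xreg yreg.
split=> //; apply: IH.
- exact: adjoin_is_ideal.
- exact: graded_adjoin yd.
- move=> g /adjoinP[h hL]; have [_ LD LM] := LI.
  have /adjoinP[h' h'L] : h \in adjoin L x.
    apply: yreg; apply/adjoinP; exists g.
    have -> : y * h - g * x = -1 * (x * g - h * y) by ring.
    exact: LM.
  apply/adjoinP; exists h'; apply: xreg.
  have -> : x * (g - h' * y) = (x * g - h * y) + y * (h - h' * x) by ring.
  by apply: LD => //; apply: LM.
- by move=> z zys; apply: ysh; rewrite inE zys orbT.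
- by apply: eq_weakly_regular ysreg; apply: adjoinC.
Qed.

End GradedIdeals.

(** * Filtration by face ideals and the elementary symmetric polynomials *)

Section LowerBound.
Variables (n : nat) (K : idomainType).
Local Notation S := {mpoly K[n]}.
Local Notation mono := 'X_{1..n}.
Implicit Types (A : {set 'I_n}) (b : 'I_n -> nat) (m : mono) (ys : seq S).

Definition meets A m := [exists i in A, (0 < m i)%N].

(** The prime P_A generated by the variables with index in [A]. *)
Definition face_ideal A : {pred S} := mideal (meets A).

Definition trunc_ge b D m := (D <= \sum_i minn (m i) (b i))%N.

Lemma meets_upclosed A : upclosed (meets A).
Proof.
move=> m k /existsP[i /andP[iA mi]]; apply/existsP; exists i.
by rewrite iA mnmDE addn_gt0 mi orbT.
Qed.

Lemma trunc_ge_upclosed b D : upclosed (trunc_ge b D).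
Proof.
move=> m k /leq_trans; apply; apply: leq_sum => i _.
by rewrite mnmDE leq_min geq_minr andbT (leq_trans (geq_minl _ _)) // leq_addl.
Qed.

Lemma face_ideal_is_ideal A : is_ideal (face_ideal A).
Proof. exact/mideal_is_ideal/meets_upclosed. Qed.

Lemma meetsD A m k : meets A (m + k)%MM = meets A m || meets A k.
Proof.
apply/existsP/orP=> [[i /andP[iA]]|[] /existsP[i /andP[iA mi]]].
- rewrite mnmDE addn_gt0 => /orP[] mi; [left|right]; apply/existsP; exists i;
  by rewrite iA.
- by exists i; rewrite iA mnmDE addn_gt0 mi.
- by exists i; rewrite iA mnmDE addn_gt0 mi orbT.
Qed.

(** P_A plus a truncated ideal. This family is stable under both steps of the filtration, L : x_i
    and L + x_i. *)
Definition mixed A b D m := meets A m || trunc_ge b D m.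

Lemma mixed_upclosed A b D : upclosed (mixed A b D).
Proof.
move=> m k /orP[mA|mb]; apply/orP; [left|right].
  exact: meets_upclosed.
exact: trunc_ge_upclosed.
Qed.

Lemma meetsU1 i A m : meets (i |: A) m = (0 < m i)%N || meets A m.
Proof.
apply/existsP/orP=> [[j]|[mi|/existsP[j /andP[jA mj]]]].
- rewrite !inE => /andP[/orP[/eqP->|jA] mj]; first by left.
  by right; apply/existsP; exists j; rewrite jA.
- by exists i; rewrite !inE eqxx.
- by exists j; rewrite !inE jA orbT.
Qed.

(** Since b_i > 0, min(m_i + 1, b_i) = min(m_i, b_i - 1) + 1, so the factor x_i uses up one unit of
    both b_i and [D]. *)
Lemma colon_mixed A b D i m : i \notin A -> (0 < b i)%N -> (0 < D)%N ->
  mixed A b D (U_(i) + m)%MM = mixed A (fun j => b j - (j == i))%N D.-1 m.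
Proof.
move=> iA bi D0; rewrite /mixed meetsD.
have -> : meets A U_(i)%MM = false.
  apply/existsP=> -[j /andP[jA]]; rewrite mnm1E.
  by case: eqP => // ij; rewrite ij jA in iA.
congr orb; rewrite /trunc_ge (bigD1 i) //= [in RHS](bigD1 i) //=.
rewrite mnmDE mnm1E !eqxx.
rewrite (eq_bigr (fun j => minn (m j) (b j - (j == i)))); last first.
  by move=> j ji; rewrite mnmDE mnm1E eq_sym (negPf ji) subn0.
by set s := (\sum_(j < n | _) _)%N; lia.
Qed.

(** A monomial prime to x_i has m_i = 0 and gets nothing from b_i, which may thus be set to 0. *)
Lemma adjoin_mixed A b D i m :
  mixed A b D m || (U_(i) <= m)%MM =
  mixed (i |: A) (fun j => if j == i then 0 else b j)%N D m.
Proof.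
rewrite lep1mP -lt0n /mixed meetsU1; case: posnP => //= [mi|]; last first.
  by rewrite orbT.
rewrite orbF; congr (_ || (_ <= _)%N); apply: eq_bigr => j _.
by case: eqP => // ->; rewrite mi min0n.
Qed.

(** Induction on the sum of [b]. A colon step lowers this sum and [D] by one; an adjoining step
    enlarges [A] by one and lowers the sum by at least one. Hence |A| + sum b - D never grows, which
    bounds the faces reached. As [b] vanishes on [A], each chosen index is new. *)
Lemma weakly_regular_mixed A b D ys : (D <= \sum_i b i)%N ->
  {in A, forall i, b i = 0%N} ->
  (forall A', A \proper A' -> (#|A'| <= #|A| + 1 + (\sum_i b i - D))%N ->
     weakly_regular (face_ideal A') ys) ->
  weakly_regular (mideal (mixed A b D)) ys.
Proof.
move: {2}(\sum_i b i)%N (leqnn (\sum_i b i)%N) => N.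
elim: N A b D => [|N IH] A b D bN Db Ab H.
  apply: weakly_regular_unit => p; apply/midealP => m _; apply/orP; right.
  by rewrite /trunc_ge; move: bN Db; rewrite leqn0 => /eqP->; rewrite leqn0 => /eqP->.
case: (posnP D) => [D0|D0].
  by apply: weakly_regular_unit => p; apply/midealP => m _; rewrite /mixed /trunc_ge D0 orbT.
have [i bi] : exists i, (0 < b i)%N.
  apply/existsP; apply: contraTT Db; rewrite negb_exists -ltnNge => /forallP b0.
  by rewrite big1 // => i _; apply/eqP; have := b0 i; rewrite -eqn0Ngt.
have iA : i \notin A by apply: contraTN bi => /Ab ->.
have sb : (\sum_j b j = b i + \sum_(j | j != i) b j)%N by rewrite (bigD1 i).
apply: (weakly_regular_colon_adjoin (x := 'X_i)).
- exact/mideal_is_ideal/mixed_upclosed.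
- apply: (eq_weakly_regular (L := mideal (mixed A (fun j => b j - (j == i))%N D.-1))).
    move=> p; have -> : (p \in colon (mideal (mixed A b D)) 'X_i) =
      ('X_i * p \in mideal (mixed A b D)) by [].
    by rewrite mideal_mulX; apply: eq_mideal => m; rewrite colon_mixed.
  have sb' : (\sum_j (b j - (j == i)) = (b i).-1 + \sum_(j | j != i) b j)%N.
    rewrite (bigD1 i) //= eqxx subn1; congr (_ + _)%N.
    by apply: eq_bigr => j /negPf ->; rewrite subn0.
  apply: IH; rewrite ?sb'.
  + by rewrite sb in bN; lia.
  + by rewrite sb in Db; lia.
  + by move=> j /Ab ->.
  + by move=> A' AA' A'c; apply: H => //; rewrite sb; lia.
- apply: (eq_weakly_regular
    (L := mideal (mixed (i |: A) (fun j => if j == i then 0 else b j)%N D))).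
    move=> p; rewrite adjoin_mideal; last exact: mixed_upclosed.
    by apply: eq_mideal => m; rewrite adjoin_mixed.
  have sb' : (\sum_j (if j == i then 0 else b j) = \sum_(j | j != i) b j)%N.
    rewrite (bigD1 i) //= eqxx add0n.
    by apply: eq_bigr => j /negPf ->.
  have AiA : A \proper i |: A.
    by rewrite properE finset.subsetUr /= finset.subUset finset.sub1set (negPf iA).
  have cA : #|i |: A| = #|A|.+1 by rewrite cardsU1 iA.
  case: (leqP D (\sum_(j | j != i) b j)%N) => Db'.
    apply: IH; rewrite ?sb' ?cA //.
    + by lia.
    + by move=> j; rewrite !inE => /orP[->|/Ab ->]; rewrite ?if_same.
    + move=> A' AA' A'c; apply: H; first exact: proper_trans AA'.
      by lia.
  (* The remaining caps sum to less than [D], so no monomial satisfies the truncation and only the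
     face ideal is left. *)
  apply: (eq_weakly_regular (L := face_ideal (i |: A))).
    apply: eq_mideal => m; rewrite /mixed /trunc_ge.
    have -> : (D <= \sum_j minn (m j) (if j == i then 0 else b j))%N = false.
      apply/negbTE; rewrite -ltnNge (leq_ltn_trans _ Db') // -sb'.
      by apply: leq_sum => j _; apply: geq_minr.
    by rewrite orbF.
  by apply: H => //; rewrite cA; lia.
Qed.

Lemma sum_minn_full (f b : 'I_n -> nat) :
  (\sum_i b i <= \sum_i minn (f i) (b i))%N -> forall i, (b i <= f i)%N.
Proof.
move=> + i; apply: contraTT; rewrite -!ltnNge => fb.
rewrite (bigD1 i) //= [ltnRHS](bigD1 i) //= -addSn leq_add //.
  by rewrite (minn_idPl (ltnW fb)).
by apply: leq_sum => j _; apply: geq_minr.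
Qed.

(** Highest degree first: modulo P_A with |A| = n - r, the head e_r reduces to a single monomial. *)
Fixpoint elem_syms r : seq S :=
  if r is r'.+1 then mesym n K r :: elem_syms r' else [::].

Lemma size_elem_syms r : size (elem_syms r) = r.
Proof. by elim: r => //= r ->. Qed.

Lemma elem_syms_homog r : {in elem_syms r, forall y, exists d, y \is d.-homog}.
Proof.
elim: r => //= r IH y; rewrite inE => /orP[/eqP->|/IH//].
by exists r.+1; apply: dhomog_mesym.
Qed.

Lemma card_setC_ord A : #|~: A| = (n - #|A|)%N.
Proof.
apply: (@addnI #|A|); rewrite (etrans (cardsC A) (card_ord n)).
by rewrite subnKC // -[leqRHS]card_ord max_card.
Qed.

(** The complement of [A] has exactly r elements, so any other squarefree monomial of degree r
    contains a variable of [A]. *)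
Lemma mesym_face_ideal A r : (r + #|A| = n)%N ->
  mesym n K r - 'X_[mesym1 (~: A)] \in face_ideal A.
Proof.
move=> rA; rewrite mesymE (bigD1 (~: A)) /=; last first.
  by rewrite card_setC_ord; apply/eqP; lia.
rewrite addrAC subrr add0r -big_filter.
apply: is_ideal_sum; first exact: face_ideal_is_ideal.
move=> h; rewrite mem_filter => /andP[/andP[/eqP hr hA] _].
rewrite mideal_monomial; apply: contraNT hA => /existsPn hA.
rewrite eqEcard; apply/andP; split.
  apply/fintype.subsetP => i ih; rewrite inE; apply/negP => iA.
  by have := hA i; rewrite iA mnmE ih.
by rewrite card_setC_ord hr; lia.
Qed.

(** Induction on r, then on n - |A|. While r + |A| < n, a variable outside [A] may be added by
    passing to a quotient. At equality e_r acts as the product of the variables outside [A], a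
    nonzerodivisor, and the rest is the case r - 1 on strictly larger faces. *)
Lemma weakly_regular_face A r : (r + #|A| <= n)%N ->
  weakly_regular (face_ideal A) (elem_syms r).
Proof.
elim: r A => // r IHr A.
move: {2}(n - #|A|)%N (leqnn (n - #|A|)%N) => N.
elim: N A => [|N IH] A AN rA; first by lia.
have AI := face_ideal_is_ideal A.
case: (ltnP (r.+1 + #|A|) n) => [rAn|rAn].
  have [i iA] : exists i, i \notin A.
    apply/existsP; apply: contraTT rAn; rewrite negb_exists => /forallP iA.
    suff -> : A = finset.setT by rewrite cardsT card_ord; lia.
    by apply/finset.setP => i; rewrite inE; have := iA i; rewrite negbK.
  have cA : #|i |: A| = #|A|.+1 by rewrite cardsU1 iA.
  apply: (weakly_regular_of_quotient (x := 'X_i) AI).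
  - exact: graded_mideal.
  - by rewrite dhomogX /= mdeg1.
  - move=> g; rewrite mideal_mulX => /midealP gA; apply/midealP => m /gA.
    rewrite meetsD => /orP[/existsP[j /andP[jA]]|//]; rewrite mnm1E.
    by case: eqP => // ij; rewrite ij jA in iA.
  - exact: elem_syms_homog.
  apply: (eq_weakly_regular (L := face_ideal (i |: A))); last by apply: IH; lia.
  move=> p; rewrite adjoin_mideal; last exact: meets_upclosed.
  by apply: eq_mideal => m; rewrite meetsU1 lep1mP lt0n orbC.
have rA' : (r.+1 + #|A| = n)%N by lia.
have eA := mesym_face_ideal rA'.
split=> [g gA|].
  have : 'X_[mesym1 (~: A)] * g \in face_ideal A.
    have [_ AD AM] := AI.
    have -> : 'X_[mesym1 (~: A)] * g =
      mesym n K r.+1 * g - g * (mesym n K r.+1 - 'X_[mesym1 (~: A)]) by ring.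
    by apply: is_idealB => //; apply: AM.
  rewrite mideal_mulX => /midealP gA'; apply/midealP => m /gA'.
  rewrite meetsD => /orP[/existsP[j /andP[jA]]|//].
  by rewrite mnmE inE jA.
(* Caps equal to 1 off [A] and 0 on it: the product of the variables outside [A] divides a monomial
   exactly when the truncated sum attains its maximum. The new ideal is thus mixed with zero slack,
   and its factors have faces of size at most |A| + 1. *)
pose b i : nat := i \in ~: A.
have sb : (\sum_i b i = r.+1)%N.
  by rewrite /b -big_mkcond /= sum1_card card_setC_ord; lia.
apply: (eq_weakly_regular (L := mideal (mixed A b r.+1))).
  move=> p; rewrite (adjoin_congr AI eA) adjoin_mideal; last exact: meets_upclosed.
  apply: eq_mideal => m; congr orb; rewrite /trunc_ge -sb.
  apply/idP/mnm_lepP => [sbm i|bm].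
    by rewrite mnmE; apply: (sum_minn_full sbm).
  by apply: leq_sum => i _; have := bm i; rewrite mnmE leq_min leqnn andbT.
apply: weakly_regular_mixed; first by rewrite sb.
  by move=> i iA; rewrite /b inE iA.
move=> A' _; rewrite sb => A'c; apply: IHr; lia.
Qed.

End LowerBound.

Arguments face_ideal {n} K A.
Arguments face_ideal_is_ideal {n} K A.

(** * Upper bound for the depth *)

Section KoszulComplex.
Variable R : comNzRingType.
Implicit Types (L : {pred R}) (xs ys gs : seq R) (c w : seq bool -> R).

(* A chain of the Koszul complex on xs is a function of the bit sequences of
   length size xs, i.e. of the subsets of xs; K(x :: xs) is the mapping cone of
   multiplication by x on K(xs). *)
Fixpoint koszul_bd xs c (t : seq bool) : R :=
  match xs, t with
  | x :: xs', e :: t' =>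
    if e then - koszul_bd xs' (fun u => c (true :: u)) t'
    else koszul_bd xs' (fun u => c (false :: u)) t' + x * c (true :: t')
  | _, _ => 0
  end.

(* Exterior multiplication by sum_i g_i e_i: a null-homotopy of the
   multiplication by sum_i g_i x_i. *)
Fixpoint koszul_homotopy gs c (t : seq bool) : R :=
  match gs, t with
  | g :: gs', e :: t' =>
    if e then g * c (false :: t') - koszul_homotopy gs' (fun u => c (true :: u)) t'
    else koszul_homotopy gs' (fun u => c (false :: u)) t'
  | _, _ => 0
  end.

Lemma eq_koszul_bd xs c c' : c =1 c' -> koszul_bd xs c =1 koszul_bd xs c'.
Proof.
elim: xs c c' => [|x xs IH] c c' cc [|e t] //=.
have IHb b : koszul_bd xs (fun u => c (b :: u)) =1 koszul_bd xs (fun u => c' (b :: u)).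
  by apply: IH => u.
by rewrite !cc !IHb.
Qed.

Lemma koszul_bdD xs a c c' t :
  koszul_bd xs (fun u => a * c u + c' u) t =
  a * koszul_bd xs c t + koszul_bd xs c' t.
Proof.
elim: xs c c' t => [|x xs IH] c c' [|e t] /=; rewrite ?mulr0 ?addr0 //.
by case: e; rewrite IH; ring.
Qed.

Lemma koszul_homotopyD xs a c c' t :
  koszul_homotopy xs (fun u => a * c u + c' u) t =
  a * koszul_homotopy xs c t + koszul_homotopy xs c' t.
Proof.
elim: xs c c' t => [|x xs IH] c c' [|e t] /=; rewrite ?mulr0 ?addr0 //.
by case: e; rewrite IH; ring.
Qed.

Lemma eq_koszul_homotopy gs c c' :
  c =1 c' -> koszul_homotopy gs c =1 koszul_homotopy gs c'.
Proof.
elim: gs c c' => [|x xs IH] c c' cc [|e t] //=.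
have IHb b : koszul_homotopy xs (fun u => c (b :: u)) =1
    koszul_homotopy xs (fun u => c' (b :: u)).
  by apply: IH => u.
by rewrite !cc !IHb.
Qed.

Lemma koszul_bd0 xs t : koszul_bd xs (fun=> 0) t = 0.
Proof.
elim: xs t => [|x xs IH] [|e t] //=.
by case: e; rewrite IH ?mulr0 ?addr0 ?oppr0.
Qed.

Lemma koszul_bdK xs c t : koszul_bd xs (koszul_bd xs c) t = 0.
Proof.
elim: xs c t => [|x xs IH] c [|[] t] //=.
  rewrite (eq_koszul_bd _ (c' := fun u => -1 * koszul_bd xs (fun u => c (true :: u)) u + 0)).
    by rewrite koszul_bdD IH koszul_bd0 mulr0 addr0 oppr0.
  by move=> u; rewrite mulN1r addr0.
rewrite (eq_koszul_bd _ (c' := fun u =>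
  x * c (true :: u) + koszul_bd xs (fun u => c (false :: u)) u)).
  by rewrite koszul_bdD IH; ring.
by move=> u; rewrite addrC.
Qed.

(** Cartan's formula for dh + hd. The cross terms cancel because boundary and homotopy both change
    sign on the summand containing the first basis vector. *)
Lemma koszul_homotopyE xs gs c t : size gs = size xs -> size t = size xs ->
  koszul_bd xs (koszul_homotopy gs c) t + koszul_homotopy gs (koszul_bd xs c) t =
  (\sum_(q <- zip gs xs) q.1 * q.2) * c t.
Proof.
elim: xs gs c t => [|x xs IH] [|g gs] c [|e t] //=.
  by rewrite big_nil mul0r addr0.
move=> [gsx] [tx]; rewrite big_cons /=.
case: e.
  rewrite (eq_koszul_bd _ (c' := fun u =>
    -1 * koszul_homotopy gs (fun u => c (true :: u)) u + g * c (false :: u))); last first.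
    by move=> u; ring.
  rewrite (eq_koszul_homotopy _ (c' := fun u =>
    -1 * koszul_bd xs (fun u => c (true :: u)) u + 0)); last first.
    by move=> u; ring.
  rewrite koszul_bdD koszul_homotopyD.
  rewrite (_ : koszul_homotopy gs (fun=> 0) t = 0); last first.
    elim: gs {gsx} t {tx} => [|h gs IHg] [|e t] //=.
    by case: e; rewrite IHg ?mulr0 ?subr0.
  have -> : koszul_bd xs (fun u => g * c (false :: u)) t =
            g * koszul_bd xs (fun u => c (false :: u)) t.
    rewrite (eq_koszul_bd _ (c' := fun u => g * c (false :: u) + 0)); last first.
      by move=> u; rewrite addr0.
    by rewrite koszul_bdD koszul_bd0 addr0.
  rewrite [RHS]mulrDl -(IH gs (fun u => c (true :: u))) //; ring.
pose c0 u := c (false :: u); pose c1 u := c (true :: u).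
have hD : koszul_homotopy gs (fun u => koszul_bd xs c0 u + x * c1 u) t =
    x * koszul_homotopy gs c1 t + koszul_homotopy gs (koszul_bd xs c0) t.
  by rewrite -koszul_homotopyD; apply: eq_koszul_homotopy => u; apply: addrC.
have := IH gs c0 t gsx tx; move: hD; rewrite -/(c0 t) /c0 /c1 /= => -> E.
rewrite [RHS]mulrDl -E; ring.
Qed.

(** Two ideals cover two uses: L' = L, and the filtration by order, where each [x] raises the order
    by one. *)
Lemma koszul_bd_mem L L' xs c t : is_ideal L' ->
  {in xs, forall x, forall g, g \in L -> x * g \in L'} ->
  (forall u, size u = size xs -> c u \in L) -> size t = size xs ->
  koszul_bd xs c t \in L'.
Proof.
move=> LI; have [L0 LD LM] := LI.
elim: xs c t => [|x xs IH] c [|e t] //= xsL cL [tx].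
have xsL' : {in xs, forall x, forall g, g \in L -> x * g \in L'}.
  by move=> z zxs; apply: xsL; rewrite inE zxs orbT.
case: e.
  by rewrite -mulN1r; apply: (LM); apply: IH => // u ux; apply: cL; rewrite /= ux.
apply: (LD); first by apply: IH => // u ux; apply: cL; rewrite /= ux.
by apply: xsL; rewrite ?inE ?eqxx //; apply: cL; rewrite /= tx.
Qed.

Lemma koszul_homotopy_mem L gs c t : is_ideal L ->
  (forall u, size u = size gs -> c u \in L) -> size t = size gs ->
  koszul_homotopy gs c t \in L.
Proof.
move=> LI; have [L0 LD LM] := LI.
elim: gs c t => [|g gs IH] c [|e t] //= cL [tx].
case: e; last by apply: IH => // u ux; apply: cL; rewrite /= ux.
apply: is_idealB => //; first by apply: LM; apply: cL; rewrite /= tx.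
by apply: IH => // u ux; apply: cL; rewrite /= ux.
Qed.

(** The offset [k] counts the true entries already split off, so that the degree condition survives
    recursion on the list. *)
Definition koszul_degree k i c := forall t, (count id t + k)%N <> i -> c t = 0.

Lemma koszul_homotopy_degree k i gs c :
  koszul_degree k i c -> koszul_degree k i.+1 (koszul_homotopy gs c).
Proof.
elim: gs k c => [|g gs IH] k c ck [|e t] //=; case: e => /= ki.
  rewrite ck ?mulr0 ?sub0r /=; last by move=> ?; apply: ki; lia.
  rewrite (IH k.+1) ?oppr0 //; last by move=> ?; apply: ki; lia.
  by move=> u ui; apply: ck => /= ?; apply: ui; lia.
by apply: (IH k) => // u ui; apply: ck => /= ?; apply: ui; lia.
Qed.

(** With h the homotopy for y, dh c = y c - h d c, so h c is a cycle modulo L + (y). If h c = d w +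
    v y modulo L, applying d yields y (c - d v) in L, and c would be a boundary. Once the sequence
    is exhausted, the bound holds because a chain of degree above the length of [xs] is zero, hence
    a boundary. *)
Lemma koszul_depth_bound L xs ys c i : is_ideal L ->
  {in ys, forall y, exists2 gs, size gs = size xs
     & y = \sum_(q <- zip gs xs) q.1 * q.2} ->
  weakly_regular L ys -> koszul_degree 0 i c ->
  (forall t, size t = size xs -> koszul_bd xs c t \in L) ->
  ~ (exists w, forall t, size t = size xs -> c t - koszul_bd xs w t \in L) ->
  (i + size ys <= size xs)%N.
Proof.
elim: ys L c i => [|y ys IH] L c i LI ysx /=.
  move=> _ ci _ cN; rewrite addn0 leqNgt; apply/negP => xi; apply: cN.
  exists (fun=> 0) => t tx; rewrite koszul_bd0 subr0 ci; first by case: LI.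
  by have := count_size id t; lia.
move=> [yreg ysreg] ci cB cN; have [L0 LD LM] := LI.
have [gs gsx yE] : exists2 gs, size gs = size xs
     & y = \sum_(q <- zip gs xs) q.1 * q.2 by apply: ysx; rewrite inE eqxx.
have hB t : size t = size xs -> koszul_bd xs (koszul_homotopy gs c) t =
    y * c t - koszul_homotopy gs (koszul_bd xs c) t.
  by move=> tx; rewrite yE -(koszul_homotopyE _ gsx tx) addrK.
have hL t : size t = size xs -> koszul_homotopy gs (koszul_bd xs c) t \in L.
  by move=> tx; apply: koszul_homotopy_mem; rewrite ?gsx.
rewrite -addSnnS; apply: (IH (adjoin L y) (koszul_homotopy gs c)).
- exact: adjoin_is_ideal.
- by move=> z zys; apply: ysx; rewrite inE zys orbT.
- by [].
- exact: koszul_homotopy_degree.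
- move=> t tx; rewrite hB //; apply/adjoinP; exists (c t).
  have -> : y * c t - koszul_homotopy gs (koszul_bd xs c) t - c t * y =
    -1 * koszul_homotopy gs (koszul_bd xs c) t by ring.
  by apply: LM; apply: hL.
move=> [w wL]; apply: cN.
(* Choosing cofactors for all entries at once makes [v] a chain; [c] turns out to be its boundary
   modulo [L]. *)
have /boolp.choice[v vL] : forall t, exists g, size t = size xs ->
    koszul_homotopy gs c t - koszul_bd xs w t - g * y \in L.
  move=> t; have [tx|tx] := eqVneq (size t) (size xs); last first.
    by exists 0 => tx'; rewrite tx' eqxx in tx.
  by have /adjoinP[g gL] := wL t tx; exists g.
exists v => t tx; apply: yreg.
have : koszul_bd xs (fun t =>
    koszul_homotopy gs c t - koszul_bd xs w t - v t * y) t \in L.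
  by apply: (koszul_bd_mem (L := L)) => // z _ g; apply: LM.
rewrite (eq_koszul_bd _ (c' := fun u => - y * v u +
  (-1 * koszul_bd xs w u + koszul_homotopy gs c u))); last by move=> u; ring.
rewrite !koszul_bdD koszul_bdK hB // => H.
have -> : y * (c t - koszul_bd xs v t) = - y * koszul_bd xs v t +
  (-1 * 0 + (y * c t - koszul_homotopy gs (koszul_bd xs c) t))
  + koszul_homotopy gs (koszul_bd xs c) t by ring.
by apply: LD => //; apply: hL.
Qed.

Definition koszul_basis (s : seq bool) (f : R) : seq bool -> R :=
  fun t => if t == s then f else 0.

(** Up to sign, the nonzero entries of the boundary of f e_s are the x_i f with i in s. *)
Lemma koszul_basis_cycle L xs s f t : is_ideal L -> size s = size xs ->
  (forall i, (i < size xs)%N -> nth false s i -> xs`_i * f \in L) ->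
  koszul_bd xs (koszul_basis s f) t \in L.
Proof.
move=> LI; have [L0 LD LM] := LI.
have e0 b e s' : b != e ->
    (fun u => koszul_basis (e :: s') f (b :: u)) =1 fun=> 0.
  by move=> be u; rewrite /koszul_basis eqseq_cons (negPf be).
have e1 e s' : (fun u => koszul_basis (e :: s') f (e :: u)) =1 koszul_basis s' f.
  by move=> u; rewrite /koszul_basis eqseq_cons eqxx.
elim: xs s t => [|x xs IH] [|e s] [|b t] //= [sx] H.
have IH' u : koszul_bd xs (koszul_basis s f) u \in L.
  by apply: IH => // i ix si; apply: (H i.+1).
case: b; case: e H => H.
- by rewrite (eq_koszul_bd _ (e1 _ _)) -mulN1r; apply: LM.
- by rewrite (eq_koszul_bd _ (e0 _ _ _ _)) // koszul_bd0 oppr0.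
- rewrite (eq_koszul_bd _ (e0 _ _ _ _)) // koszul_bd0 add0r e1 /koszul_basis.
  by case: eqP => _; [apply: (H 0%N) | rewrite mulr0].
- by rewrite (eq_koszul_bd _ (e1 _ _)) e0 // mulr0 addr0.
Qed.

End KoszulComplex.

(** * Integer points of given degree in a box *)

Section IntegerPoints.
Variable n : nat.
Implicit Types lo hi : 'I_n -> nat.

(** Starting from [lo], a coordinate still below [hi] is raised by one until the sum is [e]. *)
Lemma exists_sum_between lo hi e : (forall i, lo i <= hi i)%N ->
  (\sum_i lo i <= e)%N -> (e <= \sum_i hi i)%N ->
  exists2 u : 'X_{1..n}, mdeg u = e & forall i, (lo i <= u i <= hi i)%N.
Proof.
move: {2}(e - \sum_i lo i)%N (leqnn (e - \sum_i lo i)%N) => N.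
elim: N lo => [|N IH] lo eN lohi loe ehi.
  exists [multinom lo i | i < n]%MM; last by move=> i; rewrite mnmE leqnn lohi.
  by rewrite mdegE; under eq_bigr do rewrite mnmE; lia.
have [loe'|loe'] := leqP e (\sum_i lo i)%N.
  exists [multinom lo i | i < n]%MM; last by move=> i; rewrite mnmE leqnn lohi.
  by rewrite mdegE; under eq_bigr do rewrite mnmE; lia.
have [i lohii] : exists i, (lo i < hi i)%N.
  apply/existsP; apply: contraTT (leq_trans loe' ehi).
  rewrite negb_exists -leqNgt => /forallP hilo; apply: leq_sum => i _.
  by rewrite leqNgt.
have slo : (\sum_j (lo j + (j == i)) = (\sum_j lo j).+1)%N.
  rewrite big_split /= -addn1; congr (_ + _)%N.
  by rewrite (bigD1 i) //= eqxx big1 // => j /negPf ->.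
have [||||u ue lu] := IH (fun j => lo j + (j == i))%N; rewrite ?slo //.
- lia.
- by move=> j; case: eqP => [->|_]; rewrite ?addn1 ?addn0.
exists u => // j; have /andP[lou ->] := lu j; rewrite andbT.
by rewrite (leq_trans _ lou) // leq_addr.
Qed.

End IntegerPoints.

(** * Depth of the truncated ideals *)

Section Depth.
Variables (n : nat) (K : fieldType).
Local Notation S := {mpoly K[n]}.
Local Notation mono := 'X_{1..n}.
Implicit Types (b : 'I_n -> nat) (D : nat) (m : mono) (ys : seq S).

Definition trunc_ideal b D : {pred S} := mideal (trunc_ge b D).

Lemma trunc_ideal_is_ideal b D : is_ideal (trunc_ideal b D).
Proof. exact/mideal_is_ideal/trunc_ge_upclosed. Qed.

Lemma max_ideal_dot y : y \in max_ideal K n ->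
  exists g : 'I_n -> S, y = \sum_i g i * 'X_i.
Proof.
move=> ym; suff : y \in (fun y => `[< exists g : 'I_n -> S, y = \sum_i g i * 'X_i >]).
  by move/asboolP.
apply: ideal_gen_min ym.
  split.
  - by apply/asboolP; exists (fun=> 0); rewrite big1 // => i _; rewrite mul0r.
  - move=> u v /asboolP[g ->] /asboolP[h ->]; apply/asboolP.
    exists (fun i => g i + h i); rewrite -big_split; apply: eq_bigr => i _.
    by rewrite mulrDl.
  - move=> a u /asboolP[g ->]; apply/asboolP; exists (fun i => a * g i).
    by rewrite mulr_sumr; apply: eq_bigr => i _; rewrite mulrA.
move=> p /existsP[i /eqP ->]; apply/asboolP; exists (fun j => (j == i)%:R).
by rewrite (bigD1 i) //= eqxx mul1r big1 ?addr0 // => j /negPf->; rewrite mul0r.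
Qed.

Lemma mem_max_ideal p : (p \in max_ideal K n) = (p \in mideal (fun m => 0 < mdeg m)%N).
Proof.
apply/idP/idP.
  apply: ideal_gen_min.
    apply: mideal_is_ideal => m k; rewrite mdegD addn_gt0 => ->; exact: orbT.
  by move=> q /existsP[i /eqP ->]; rewrite mideal_monomial mdeg1.
move=> /midealP pV; apply: mem_ideal_monomials; first exact: ideal_gen_is_ideal.
move=> m /pV; rewrite lt0n mdeg_eq0 => m0.
have [i mi] : exists i, m i != 0%N.
  apply/existsP; apply: contraNT m0; rewrite negb_exists => /forallP m0.
  by apply/eqP/mnmP => i; rewrite mnm0E; apply/eqP; have := m0 i; rewrite negbK.
rewrite -lep1mP in mi; rewrite -(submK mi) mpolyXD.
by apply/ideal_genM/ideal_gen_sub; apply/existsP; exists i.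
Qed.

Lemma depth_upper_bound b D ys : (0 < n)%N -> (forall i, 0 < b i)%N ->
  (0 < D)%N -> (D <= \sum_i b i)%N -> {subset ys <= max_ideal K n} ->
  weakly_regular (trunc_ideal b D) ys -> (size ys <= n - (\sum_i b i - D).+1)%N.
Proof.
move=> n0 b0 D0 Db ysm ysreg.
(* The number of basis vectors in the cycle: slack plus one, capped by the number of variables. *)
pose q := minn (\sum_i b i - D).+1 n.
have q0 : (0 < q)%N by rewrite /q; lia.
(* The exponent u has degree D - 1 and room for one more unit at the first q indices, so x_i x^u
   lies in the ideal there. The upper bounds sum to at least D - 1 because q is at most the slack
   plus one. *)
have [|||u uD ub] := @exists_sum_between n (fun=> 0%N) (fun i => b i - (i < q))%N D.-1.
- by [].
- by rewrite big1.
- have qE : (\sum_(i < n) (i < q) = q)%N.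
    rewrite -big_mkcond /= (big_ord_narrow (geq_minr _ _)) /= sum_nat_const.
    by rewrite card_ord muln1.
  have sq : (\sum_i (b i - (i < q)) + \sum_(i < n) (i < q) = \sum_i b i)%N.
    rewrite -big_split; apply: eq_bigr => i _ /=; rewrite subnK //.
    by case: (i < q)%N; rewrite ?b0.
  rewrite qE in sq.
  by move: sq; rewrite /q; set s := (\sum_i b i)%N; lia.
pose xs : seq S := [seq 'X_i | i <- enum 'I_n].
have sxs : size xs = n by rewrite size_map size_enum_ord.
have xsE (i : 'I_n) : xs`_i = 'X_i.
  by rewrite (nth_map i) ?size_enum_ord // nth_ord_enum.
pose s := [seq (i < q)%N | i <- iota 0 n].
have ss : size s = n by rewrite size_map size_iota.
have sE (i : 'I_n) : nth false s i = (i < q)%N.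
  by rewrite (nth_map 0%N) ?size_iota // nth_iota.
have cs : count id s = q.
  rewrite count_map -sum1_count big_mkcond /= -[n in iota _ n]subn0 big_mkord.
  rewrite -big_mkcond /= (big_ord_narrow (geq_minr _ _)) /= sum_nat_const.
  by rewrite card_ord muln1.
suff : (q + size ys <= size xs)%N by rewrite sxs /q; lia.
apply: (koszul_depth_bound (L := trunc_ideal b D) (c := koszul_basis s 'X_[u])).
- exact: trunc_ideal_is_ideal.
- move=> y /ysm /max_ideal_dot[g ->].
  exists [seq g i | i <- enum 'I_n]; first by rewrite !size_map.
  by rewrite zip_map big_map -big_enum.
- by [].
- move=> t; rewrite addn0 /koszul_basis; case: eqP => // ->; by rewrite cs.
- move=> t tx; apply: koszul_basis_cycle; first exact: trunc_ideal_is_ideal.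
    by rewrite ss sxs.
  rewrite sxs => i iltn; rewrite (sE (Ordinal iltn)) (xsE (Ordinal iltn)) => iq.
  rewrite -mpolyXD mideal_monomial /trunc_ge.
  rewrite (eq_bigr (fun j => (U_(Ordinal iltn) + u)%MM j)).
    by rewrite -mdegE mdegD mdeg1 uD add1n prednK.
  move=> j _; apply/minn_idPl; rewrite mnmDE mnm1E.
  have /andP[_] := ub j; case: eqP => [<- /=|_]; last by lia.
  by rewrite iq; have := b0 (Ordinal iltn); lia.
move=> [w wL].
(* Suppose x^u e_s is d w modulo the ideal. The difference has order at least D, so its boundary has
   order at least D + 1; but d d w = 0, and the boundary of x^u e_s has an entry x_0 x^u of degree
   D. *)
pose ord e := mideal (fun m => e <= mdeg m)%N : {pred S}.
have ordI e : is_ideal (ord e).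
  by apply: mideal_is_ideal => m k; rewrite mdegD; lia.
(* As q > 0, [s] begins with true; clearing that bit gives the position of this entry. *)
have t0 : exists t, size t = n /\ s = true :: behead s /\ t = false :: behead s.
  exists (false :: behead s); split; last by split=> //; rewrite /s -(prednK n0) /= q0.
  by rewrite /= size_behead ss prednK.
have [t [tn [sb tE]]] := t0.
have : koszul_bd xs (fun t => koszul_basis s 'X_[u] t - koszul_bd xs w t) t
    \in ord D.+1.
  apply: (koszul_bd_mem (L := ord D)) => //; last by rewrite sxs.
    move=> x /mapP[i _ ->] g; rewrite mideal_mulX => /midealP gD.
    by apply/midealP => m /gD; rewrite mdegD mdeg1.
  move=> v /wL /midealP wLv; apply/midealP => m /wLv; rewrite /trunc_ge => /leq_trans.
  by apply; rewrite mdegE; apply: leq_sum => i _; apply: geq_minl.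
rewrite (eq_koszul_bd _ (c' := fun v =>
  -1 * koszul_bd xs w v + koszul_basis s 'X_[u] v)); last by move=> v; ring.
rewrite koszul_bdD koszul_bdK mulr0 add0r.
have xs0 : xs = 'X_(Ordinal n0) :: behead xs.
  have := xsE (Ordinal n0) => /=; case: (xs) sxs => [|x xs'] /=; last by move=> _ ->.
  by move=> n00; move: n0; rewrite -n00.
rewrite xs0 tE sb /=.
rewrite (eq_koszul_bd _ (c' := fun=> 0)); last by move=> v.
rewrite koszul_bd0 add0r /koszul_basis eqxx -mpolyXD mideal_monomial.
by rewrite mdegD mdeg1 uD add1n prednK // ltnn.
Qed.

Lemma depth_lower_bound b D : (D <= \sum_i b i)%N ->
  weakly_regular (trunc_ideal b D)
    (elem_syms n K (n - (\sum_i b i - D).+1)).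
Proof.
move=> Db; apply: (eq_weakly_regular (L := mideal (mixed finset.set0 b D))).
  apply: eq_mideal => m; rewrite /mixed.
  have -> // : meets finset.set0 m = false.
  by apply/existsP => -[i]; rewrite inE.
apply: weakly_regular_mixed => // [i|A]; first by rewrite inE.
rewrite finset.cards0 add0n => A0 Ac.
case: (leqP n (\sum_i b i - D).+1) => h.
  by have -> : (n - (\sum_i b i - D).+1 = 0)%N by lia.
by apply: weakly_regular_face; lia.
Qed.

Lemma depth_trunc_ideal b D : (0 < n)%N -> (forall i, 0 < b i)%N ->
  (0 < D)%N -> (D <= \sum_i b i)%N ->
  is_depth (max_ideal K n) (trunc_ideal b D) (n - (\sum_i b i - D).+1).
Proof.
move=> n0 b0 D0 Db; have TI := trunc_ideal_is_ideal b D; split; last first.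
  by move=> ys ysm /(regular_seqP _ TI)[ysreg _]; apply: depth_upper_bound.
have em r : {subset elem_syms n K r <= max_ideal K n}.
  elim: r => // r IH y; rewrite inE => /orP[/eqP ->|/IH //].
  rewrite mem_max_ideal; apply/midealP => m.
  by move/(dhomog_mf (dhomog_mesym n K r.+1)) => /= ->.
exists (elem_syms n K (n - (\sum_i b i - D).+1)); split=> //.
  exact: size_elem_syms.
apply/(regular_seqP _ TI); split; first exact: depth_lower_bound.
(* Properness: the truncated ideal, because D > 0, and the sequence both lie in the maximal
   ideal. *)
apply/negP => /(foldl_adjoin_min (J := max_ideal K n)) one.
have : 1 \in max_ideal K n.
  apply: one => //; first exact: ideal_gen_is_ideal.
  move=> p /midealP pT; rewrite mem_max_ideal; apply/midealP => m /pT.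
  move=> h; rewrite (leq_trans D0) // (leq_trans h) // mdegE.
  by apply: leq_sum => i _; apply: geq_minl.
by rewrite mem_max_ideal -mpolyX0 mideal_monomial mdeg0.
Qed.

End Depth.

Arguments trunc_ideal {n} K b D.
Arguments trunc_ideal_is_ideal {n} K b D.

(** * Powers and associated primes *)

Section Powers.
Variables (n : nat) (K : fieldType).
Local Notation S := {mpoly K[n]}.
Local Notation mono := 'X_{1..n}.
Implicit Types (a b : 'I_n -> nat) (d D k : nat) (m : mono).

(** A monomial x^m with sum min(m_i, a_i) >= d is a multiple of a generator: some u of degree d lies
    below both m and a. *)
Lemma veronese_idealE a d : veronese_ideal K n d a =i trunc_ideal K a d.
Proof.
move=> p; apply/idP/idP.
  apply: ideal_gen_min; first exact: trunc_ideal_is_ideal.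
  move=> q /asboolP[u [ud ua ->]]; rewrite mideal_monomial /trunc_ge -ud mdegE.
  by apply: leq_sum => i _; rewrite leq_min leqnn ua.
move=> /midealP pT; apply: mem_ideal_monomials; first exact: ideal_gen_is_ideal.
move=> m /pT dm.
have [|||u ud um] := @exists_sum_between n (fun=> 0%N) (fun i => minn (m i) (a i)) d.
- by [].
- by rewrite big1.
- exact: dm.
have um' : (u <= m)%MM.
  by apply/mnm_lepP => i; have := um i; lia.
rewrite -(submK um') mpolyXD; apply/ideal_genM/ideal_gen_sub.
apply/asboolP; exists u; split=> // i.
by have := um i; rewrite leq_min => /and3P[].
Qed.

Lemma eq_trunc_ideal b b' D : b =1 b' -> trunc_ideal K b D =i trunc_ideal K b' D.
Proof.
move=> bb; apply: eq_mideal => m; congr (_ <= _)%N.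
by apply: eq_bigr => i _; rewrite bb.
Qed.

Lemma ideal_exp_veronese a d k :
  ideal_exp (veronese_ideal K n d a) k =i
  trunc_ideal K (fun i => k * a i)%N (k * d).
Proof.
elim: k => [|k IH] p.
  have -> : (p \in ideal_exp (veronese_ideal K n d a) 0%N) = true by [].
  by apply/esym/midealP => m _; rewrite /trunc_ge mul0n.
apply/idP/idP.
  apply: ideal_gen_min; first exact: trunc_ideal_is_ideal.
  move=> q /asboolP[u [v []]]; rewrite veronese_idealE IH.
  move=> /midealP uT /midealP vT ->; apply/midealP => m /msuppM_le.
  case/allpairsP=> -[m1 m2] /= [/uT m1T /vT m2T ->]; rewrite /trunc_ge mulSn.
  apply: (leq_trans (leq_add m1T m2T)); rewrite -big_split; apply: leq_sum => i _.
  by rewrite mnmDE mulSn /=; lia.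
move=> /midealP pT; apply: mem_ideal_monomials; first exact: ideal_gen_is_ideal.
move=> m /pT dm.
have [|||v vd vm] :=
  @exists_sum_between n (fun=> 0%N) (fun i => minn (m i) (k.+1 * a i)) (k.+1 * d).
- by [].
- by rewrite big1.
- exact: dm.
have va i : (v i <= k.+1 * a i)%N by have := vm i; rewrite leq_min => /and3P[].
have vmi i : (v i <= m i)%N by have := vm i; rewrite leq_min => /and3P[].
(* To split v as u plus an exponent belonging to I^k, u must lie between max(0, v - k a) and min(v,
   a). The real vector v / (k + 1), of degree d, satisfies both bounds, so their sums enclose d and
   an integer choice exists. *)
have [|||u ud uv] :=
  @exists_sum_between n (fun i => v i - k * a i)%N (fun i => minn (v i) (a i)) d.
- by move=> i; have := va i; rewrite mulSn; lia.
- rewrite -(leq_pmul2l (ltn0Sn k)) -vd mdegE big_distrr; apply: leq_sum => i _ /=.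
  have [vk|vk] := leqP (v i) (k * a i); first by rewrite (eqP vk) muln0.
  have : (k * (v i - k * a i) <= k * a i)%N.
    by rewrite leq_mul2l; have := va i; rewrite mulSn; lia.
  by rewrite mulSn; lia.
- rewrite -(leq_pmul2l (ltn0Sn k)) -vd mdegE big_distrr; apply: leq_sum => i _ /=.
  have [vk|vk] := leqP (v i) (a i); first by rewrite leq_pmull.
  exact: va.
have um : (u <= m)%MM.
  by apply/mnm_lepP => i; have := uv i; have := vmi i; lia.
rewrite -(submK um) mpolyXD mulrC; apply: ideal_gen_sub; apply/asboolP.
exists 'X_[u], 'X_[m - u]; split=> //.
  rewrite veronese_idealE mideal_monomial /trunc_ge -ud mdegE; apply: leq_sum => i _.
  by have := uv i; lia.
rewrite IH mideal_monomial /trunc_ge.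
have -> : (k * d = mdeg (v - u)%MM)%N.
  have uv' : (u <= v)%MM by apply/mnm_lepP => i; have := uv i; lia.
  by have := congr1 mdeg (submK uv'); rewrite mdegD vd ud mulSn; lia.
rewrite mdegE; apply: leq_sum => i _; rewrite !mnmBE.
by have := uv i; have := vmi i; lia.
Qed.

End Powers.

(** * Associated primes of the truncated ideals *)

Section AssociatedPrimes.
Variables (n : nat) (K : fieldType).
Local Notation S := {mpoly K[n]}.
Local Notation mono := 'X_{1..n}.
Implicit Types (A : {set 'I_n}) (b : 'I_n -> nat) (D k : nat) (m : mono) (p f g : S).

Lemma avoid_meets_mul A p q :
  {in msupp p, forall m, ~~ meets A m} -> {in msupp q, forall m, ~~ meets A m} ->
  p * q \in face_ideal K A -> p * q = 0.
Proof.
move=> pA qA /midealP pqA; apply: msuppnil0.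
case E : (msupp (p * q)) => [//|m s].
have mpq : m \in msupp (p * q) by rewrite E inE eqxx.
have := pqA m mpq; case/msuppM_le/allpairsP: mpq => -[m1 m2] /= [/pA m1A /qA m2A ->].
by rewrite meetsD (negPf m1A) (negPf m2A).
Qed.

(** Modulo P_A a polynomial equals its part free of the variables in [A]. A product of such parts is
    again free of them, so it lies in P_A only if it is zero, and S is a domain. *)
Lemma face_ideal_prime A : is_prime_ideal (face_ideal K A).
Proof.
have AI := face_ideal_is_ideal K A; have [A0 AD AM] := AI.
split.
  split=> //.
    rewrite -mpolyX0 mideal_monomial; apply/existsP => -[i].
    by rewrite mnm0E andbF.
  by move=> c u v uA vA; apply: (AD) => //; apply: AM.
move=> u v uvA; pose r p := mpart (predC (meets A)) p.
have rA p : {in msupp (r p), forall m, ~~ meets A m}.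
  by move=> m; rewrite msupp_mpart => /andP[].
have pr p : p - r p \in face_ideal K A.
  rewrite sub_mpart; apply/midealP => m; rewrite msupp_mpart /= negbK.
  by case/andP.
have rP p : r p = 0 -> p \in face_ideal K A by move=> rp; rewrite -[p]subr0 -rp.
have : r u * r v \in face_ideal K A.
  have -> : r u * r v = u * v - (r v * (u - r u) + u * (v - r v)) by ring.
  by apply: is_idealB => //; apply: (AD); apply: (AM).
move/(avoid_meets_mul (rA u) (rA v))/eqP; rewrite mulf_eq0.
by move=> /orP[] /eqP/rP ->; rewrite ?orbT.
Qed.

Lemma mem_face_ideal_X A i : ('X_i \in face_ideal K A) = (i \in A).
Proof.
rewrite mideal_monomial; apply/existsP/idP => [[j /andP[jA]]|iA].
  by rewrite mnm1E; case: eqP => // ->.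
by exists i; rewrite iA mnm1E eqxx.
Qed.

(** Off [A] the caps are already reached by w, and on [A] the factor m contributes nothing. *)
Lemma trunc_ge_saturated A b D (w m : mono) : (forall i, i \notin A -> b i <= w i)%N ->
  (forall i, i \in A -> m i = 0%N) -> trunc_ge b D (m + w)%MM = trunc_ge b D w.
Proof.
move=> bw m0; congr (_ <= _)%N; apply: eq_bigr => i _; rewrite mnmDE.
have [iA|iA] := boolP (i \in A); first by rewrite m0.
by have := bw i iA; lia.
Qed.

Lemma not_meets A m : ~~ meets A m -> forall i, i \in A -> m i = 0%N.
Proof.
by move=> /existsPn mA i iA; have := mA i; rewrite iA /= -eqn0Ngt => /eqP.
Qed.

Lemma assoc_prime_trunc_ideal b D (P : {pred S}) : (forall i, 0 < b i)%N ->
  (D <= \sum_i b i)%N ->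
  is_assoc_prime (trunc_ideal K b D) P <->
  exists A, [/\ P =i face_ideal K A, (\sum_(i | i \notin A) b i < D)%N
    & (#|A| + D <= (\sum_i b i).+1)%N].
Proof.
move=> b0 Db; have TI := trunc_ideal_is_ideal K b D; have [T0 TD TM] := TI.
have split_sum A (F : 'I_n -> nat) :
    (\sum_i F i = \sum_(i in A) F i + \sum_(i | i \notin A) F i)%N.
  by rewrite (bigID (mem A)).
split; last first.
  move=> [A [PA sA cA]]; split.
    have [[F0 F1 FM] FP] := face_ideal_prime A; split; first split.
    - by rewrite PA.
    - by rewrite PA.
    - by move=> c u v; rewrite !PA; apply: FM.
    - by move=> u v; rewrite !PA; apply: FP.
  (* The witness is x^u of degree D - 1 with u = b off [A] and u < b on [A]: a monomial multiplies
     it into the ideal exactly when it contains a variable of [A]. The two inequalities on [A] say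
     that such a u exists. *)
  have [|||u uD ub] := @exists_sum_between n
     (fun i => if i \in A then 0 else b i)%N
     (fun i => if i \in A then (b i).-1 else b i)%N D.-1.
  - by move=> i; case: ifP.
  - rewrite (split_sum A) big1 ?add0n; last by move=> i ->.
    rewrite (eq_bigr b) => [|i /negPf ->//].
    by rewrite -ltnS (ltn_predK sA).
  - rewrite (split_sum A) (eq_bigr (fun i => (b i).-1)) => [|i ->//].
    rewrite [X in (_ + X)%N](eq_bigr b) => [|i /negPf ->//].
    have bE : (\sum_(i in A) b i = #|A| + \sum_(i in A) (b i).-1)%N.
      by rewrite -sum1_card -big_split; apply: eq_bigr => i _ /=; rewrite add1n prednK.
    move: cA; rewrite (split_sum A b) bE -addnA -addnS leq_add2l.
    by case: (D).
  have uA i : i \notin A -> (b i <= u i)%N.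
    by move=> /negPf iA; have := ub i; rewrite iA => /andP[].
  have ule i : (u i <= b i)%N.
    by have := ub i; case: ifP => _; have := b0 i; lia.
  have su : (\sum_i minn (u i) (b i) = D.-1)%N.
    by rewrite -uD mdegE; apply: eq_bigr => i _; apply/minn_idPl.
  have D0 : (0 < D)%N by apply: leq_ltn_trans sA.
  exists 'X_[u] => g; rewrite PA mulrC mideal_mulX.
  apply/eq_mideal => m; rewrite addmC.
  have [mA|mA] := boolP (meets A m).
    have /existsP[i /andP[iA mi]] := mA; apply/esym; rewrite /trunc_ge.
    rewrite -(prednK D0) -su (bigD1 i) //= [ltnRHS](bigD1 i) //= -addSn leq_add //.
      rewrite mnmDE; have := ub i; rewrite iA /=; have := b0 i; lia.
    by apply: leq_sum => j _; rewrite mnmDE; lia.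
  rewrite (trunc_ge_saturated _ uA (not_meets mA)) /trunc_ge su.
  by apply/esym/negbTE; rewrite -ltnNge prednK.
move=> [[[P0 P1 PM] PP] [f Pf]].
have PI : is_ideal P.
  split=> // [u v uP vP|c u uP]; first by rewrite -[u]mul1r; apply: PM.
  by rewrite -[c * u]addr0; apply: PM.
pose A := [set i | 'X_i \in P]%SET.
(* Multiplying f by x^w saturates the caps off [A]; since x^w is not in the prime P, the annihilator
   is unchanged. *)
pose w := [multinom (if i \in A then 0 else b i)%N | i < n].
have wP : 'X_[w] \notin P.
  rewrite mpolyXE_id; elim/big_rec: _ => //= i y _ yP.
  apply/negP => /PP /orP[]; last by apply/negP.
  rewrite mnmE; case: ifP => [_|]; first by rewrite expr0; apply/negP.
  rewrite inE => iA; elim: (b i) => [|k IH]; first by rewrite expr0; apply/negP.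
  by rewrite exprS => /PP; rewrite iA.
pose f' := 'X_[w] * f.
have Pf' g : (g \in P) = (g * f' \in trunc_ideal K b D).
  rewrite /f' mulrA -Pf; apply/idP/idP => [gP|/PP/orP[//|]].
    by rewrite mulrC; case: PI => _ _; apply.
  by rewrite (negPf wP).
have f'w m : m \in msupp f' -> forall i, i \notin A -> (b i <= m i)%N.
  rewrite /f' mulrC (perm_mem (msuppMX _ _)) => /mapP[m' _ ->] i iA.
  by rewrite mnmDE mnmE (negPf iA) leq_addr.
(* Some monomial v of f' is outside the ideal, while each x_i x^v with i in [A] is inside; so if [A]
   is nonempty, v has truncated sum D - 1 and v_i < b_i on [A]. *)
have [v vf' vT] : exists2 v, v \in msupp f' & ~~ trunc_ge b D v.
  by apply/allPn; move: P1; rewrite Pf' mul1r.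
have vA i : i \in A -> trunc_ge b D (U_(i) + v)%MM.
  rewrite inE Pf' mulrC => /midealP; apply.
  rewrite (perm_mem (msuppMX _ _)); apply/mapP; by exists v.
have sv : (\sum_i minn (v i) (b i) < D)%N by rewrite ltnNge.
have vb i : i \in A -> (v i < b i)%N /\ (\sum_i minn (v i) (b i) = D.-1)%N.
  move=> iA; have := vA i iA; rewrite /trunc_ge.
  have -> : (\sum_j minn ((U_(i) + v)%MM j) (b j) =
      minn (v i).+1 (b i) + \sum_(j | j != i) minn (v j) (b j))%N.
    rewrite (bigD1 i) //= mnmDE mnm1E eqxx; congr (_ + _)%N.
    by apply: eq_bigr => j /negPf ji; rewrite mnmDE mnm1E eq_sym ji.
  move: sv; rewrite (bigD1 i) //=; set s := (\sum_(j | j != i) _)%N; lia.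
have svA : (\sum_(i | i \notin A) minn (v i) (b i) = \sum_(i | i \notin A) b i)%N.
  by apply: eq_bigr => i iA; apply/minn_idPr/f'w.
exists A; split.
- move=> g; apply/idP/idP; last first.
    move=> /midealP gA; apply: mem_ideal_monomials => // m /gA /existsP[i].
    rewrite inE lt0n -lep1mP => /andP[iP im].
    by rewrite -(submK im) mpolyXD; case: PI => _ _; apply.
  (* To see that g is in P_A, let h be its part free of [A] and f2 the part of f' outside the ideal.
     By saturation a product of their monomials is never in the ideal, whereas h f2 is; so h f2 = 0,
     and f2 contains v, whence h = 0. *)
  move=> gP; pose h := mpart (predC (meets A)) g.
  have hP : h \in P.
    have -> : h = g - (g - h) by ring.
    apply: is_idealB => //; rewrite sub_mpart; apply: mem_ideal_monomials => // m.
    rewrite msupp_mpart /= negbK => /andP[/existsP[i]].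
    rewrite inE lt0n -lep1mP => /andP[iP im] _.
    by rewrite -(submK im) mpolyXD; case: PI => _ _; apply.
  pose f2 := mpart (predC (trunc_ge b D)) f'.
  have f2f' : f' - f2 \in trunc_ideal K b D.
    rewrite sub_mpart; apply/midealP => m; rewrite msupp_mpart /= negbK.
    by case/andP.
  have hf2 : h * f2 \in trunc_ideal K b D.
    have -> : h * f2 = h * f' - h * (f' - f2) by ring.
    by apply: is_idealB => //; [rewrite -Pf' | apply: TM].
  have : h * f2 = 0.
    apply: msuppnil0; case E : (msupp (h * f2)) => [//|m s].
    have mhf : m \in msupp (h * f2) by rewrite E inE eqxx.
    have := allP hf2 m mhf; case/msuppM_le/allpairsP: mhf => -[m1 m2] /= [].
    rewrite !msupp_mpart => /andP[/= m1A _] /andP[/= m2T m2f] ->.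
    by rewrite (trunc_ge_saturated _ (f'w _ m2f) (not_meets m1A)) (negPf m2T).
  move/eqP; rewrite mulf_eq0 => /orP[]/eqP h0.
    by rewrite -[g]subr0 -h0 sub_mpart; apply/midealP => m;
      rewrite msupp_mpart /= negbK => /andP[].
  have : v \in msupp f2 by rewrite msupp_mpart /= vT.
  by rewrite h0 msupp0.
- by rewrite (leq_ltn_trans _ sv) // (split_sum A) svA leq_addl.
- have [A0|[i iA]] := finset.set_0Vmem A.
    rewrite A0 finset.cards0 add0n.
    by rewrite leqW.
  have [_ sD] := vb i iA.
  have cA : (#|A| + \sum_(i in A) minn (v i) (b i) <= \sum_(i in A) b i)%N.
    rewrite -sum1_card -big_split; apply: leq_sum => j jA.
    by have [+ _] := vb j jA; rewrite /=; lia.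
  have D0 : (0 < D)%N by apply: leq_ltn_trans sv.
  rewrite (split_sum A b) -svA -(prednK D0) -sD (split_sum A) addnS ltnS.
  by rewrite addnA leq_add2r.
Qed.

End AssociatedPrimes.

(** * Dimension of the fiber ring *)

Section PrimeChains.
Local Open Scope quotient_scope.
Implicit Types A B : comNzRingType.

Lemma prime_ideal_is_ideal A (P : {pred A}) : is_prime_ideal P -> is_ideal P.
Proof.
move=> [[P0 _ PM] _]; split=> // [u v uP vP|c u uP].
  by rewrite -[u]mul1r; apply: PM.
by rewrite -[c * u]addr0; apply: PM.
Qed.

Lemma rmorph_kernel_prime A (B : idomainType) (f : {rmorphism A -> B}) :
  is_prime_ideal (fun z => f z == 0).
Proof.
split; first split.
- by rewrite unfold_in rmorph0.
- by rewrite unfold_in rmorph1 oner_eq0.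
- move=> c u v; rewrite !unfold_in => /eqP fu /eqP fv.
  by rewrite rmorphD rmorphM fu fv mulr0 addr0.
- by move=> u v; rewrite !unfold_in rmorphM mulf_eq0.
Qed.

(** Congruence modulo I is absorbed by P, so the chosen representative does not matter. *)
Lemma repr_pi_ideal A (I : idealr A) (P : {pred A}) (z : A) :
  {subset I <= P} -> is_ideal P ->
  (repr (\pi_({ideal_quot I}) z) \in P) = (z \in P).
Proof.
move=> IP PI; set z' := repr _.
have zz' : z' - z \in P.
  by apply: IP; rewrite Quotient.idealrBE; apply/eqP; rewrite reprK.
have [_ PD _] := PI; apply/idP/idP => zP.
  have -> : z = z' - (z' - z) by ring.
  exact: is_idealB.
by rewrite -(subrK z z'); apply: PD.
Qed.

Lemma prime_ideal_quot A (I : idealr A) (P : {pred A}) :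
  {subset I <= P} -> is_prime_ideal P ->
  is_prime_ideal (fun z : {ideal_quot I} => repr z \in P).
Proof.
move=> IP PP; have PI := prime_ideal_is_ideal PP; have [[P0 P1 PM] PPr] := PP.
have piP z : (repr (\pi_({ideal_quot I}) z) \in P) = (z \in P).
  exact: repr_pi_ideal.
split; first split.
- have <- : \pi_({ideal_quot I}) 0 = 0 by rewrite rmorph0.
  exact: etrans (piP 0) P0.
- have <- : \pi_({ideal_quot I}) 1 = 1 by rewrite rmorph1.
  exact: etrans (congr1 negb (piP 1)) P1.
- move=> c u v; rewrite !unfold_in => uP vP.
  have -> : c * u + v = \pi_({ideal_quot I}) (repr c * repr u + repr v).
    by rewrite rmorphD rmorphM /= !reprK.
  exact: etrans (piP _) (PM _ _ _ uP vP).
- move=> u v.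
  have -> : u * v = \pi_({ideal_quot I}) (repr u * repr v).
    by rewrite rmorphM /= !reprK.
  by move=> uvP; apply: PPr; apply: etrans (esym (piP _)) uvP.
Qed.

Lemma prime_ideal_pi A (I : idealr A) (P : {pred {ideal_quot I}}) :
  is_prime_ideal P -> is_prime_ideal (fun z : A => \pi_({ideal_quot I}) z \in P).
Proof.
move=> [[P0 P1 PM] PP]; split; first split.
- by rewrite unfold_in rmorph0.
- by rewrite unfold_in rmorph1.
- by move=> c u v; rewrite !unfold_in rmorphD rmorphM; apply: PM.
- by move=> u v; rewrite !unfold_in rmorphM; apply: PP.
Qed.

Fixpoint exponents l M : seq (seq nat) :=
  if l is l'.+1 then [seq j :: e | j <- iota 0 M, e <- exponents l' M]
  else [:: [::]].

Lemma size_exponents l M : size (exponents l M) = (M ^ l)%N.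
Proof. by elim: l => //= l IH; rewrite size_allpairs size_iota IH expnS. Qed.

Lemma exponents_uniq l M : uniq (exponents l M).
Proof.
elim: l => //= l IH; apply: allpairs_uniq; rewrite ?iota_uniq //.
by move=> [i e] [j f] _ _ /= [-> ->].
Qed.

Lemma exponentsP l M e :
  reflect (size e = l /\ {in e, forall j, j < M}%N) (e \in exponents l M).
Proof.
elim: l e => [|l IH] e /=.
  rewrite inE; apply: (iffP eqP) => [->|[/size0nil->]//].
  by split.
apply: (iffP allpairsP) => [[[j f] /=]|[]].
  rewrite mem_iota add0n /= => -[jM /IH[<- fM] ->]; split=> // i.
  by rewrite inE => /orP[/eqP ->//|/fM].
case: e => // j e [el] ejM; exists (j, e); split=> //.
  by rewrite mem_iota add0n /=; apply: ejM; rewrite inE eqxx.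
by apply/IH; split=> // i ie; apply: ejM; rewrite inE ie orbT.
Qed.

Definition power_product A (xs : seq A) (e : seq nat) : A :=
  \prod_(q <- zip xs e) q.1 ^+ q.2.

(** The constant term lies in P', as x and the whole sum do, and is therefore 0 by assumption; then
    x, which is not in P, can be cancelled and the number of terms drops. *)
Lemma horner_mem_prime A (P P' : {pred A}) x (T : nat -> A) M :
  is_prime_ideal P -> is_prime_ideal P' -> {subset P <= P'} ->
  x \notin P -> x \in P' -> (forall i, T i \in P' -> T i = 0) ->
  \sum_(i < M) x ^+ i * T i \in P -> forall i, (i < M)%N -> T i \in P'.
Proof.
move=> PP PP' sPP' xP xP'; elim: M T => // M IH T T0; rewrite big_ord_recl mul1r.
have -> : \sum_(i < M) x ^+ lift ord0 i * T (lift ord0 i) =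
    x * \sum_(i < M) x ^+ i * T i.+1.
  by rewrite mulr_sumr; apply: eq_bigr => i _; rewrite exprS mulrA.
set s := \sum_(i < M) _ => TsP.
have [P'0 P'D P'M] := prime_ideal_is_ideal PP'.
have TP : T 0%N \in P'.
  have -> : T 0%N = (T 0%N + x * s) - s * x by ring.
  by apply: is_idealB; [apply: prime_ideal_is_ideal | apply: sPP' | apply: P'M].
have sP : s \in P.
  move: TsP; rewrite (T0 _ TP) add0r => /(proj2 PP).
  by rewrite (negPf xP).
by case=> [|i] //; apply: (IH (fun i => T i.+1) (fun i => T0 i.+1) sP).
Qed.

(* The lowest exponent of x_0 in a relation among the x_i can be cancelled modulo
   P 0, and then everything but its coefficient vanishes modulo P 1. *)
Lemma chain_power_products_free (K : fieldType) A (kappa : {rmorphism K -> A})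
    (P : nat -> {pred A}) (xs : seq A) M (c : seq nat -> K) :
  (forall i, (i <= size xs)%N -> is_prime_ideal (P i)) ->
  (forall i, (i < size xs)%N -> {subset P i <= P i.+1}) ->
  (forall i, (i < size xs)%N -> xs`_i \notin P i /\ xs`_i \in P i.+1) ->
  \sum_(e <- exponents (size xs) M) kappa (c e) * power_product xs e \in P 0%N ->
  {in exponents (size xs) M, forall e, c e = 0}.
Proof.
elim: xs P c => [|x xs IH] P c /= PP sP xP.
  rewrite big_seq1 /power_product big_nil mulr1 => cP e; rewrite inE => /eqP ->.
  apply: contraTeq cP => c0; apply/negP => cP.
  have [[_ P1 _] _] := PP 0%N isT; have [_ _ PM] := prime_ideal_is_ideal (PP 0%N isT).
  by move/negP: P1; apply; rewrite -(rmorph1 kappa) -(mulVf c0) rmorphM; apply: PM.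
pose T i := \sum_(e <- exponents (size xs) M) kappa (c (i :: e)) * power_product xs e.
have T0 i : T i \in P 1%N -> {in exponents (size xs) M, forall e, c (i :: e) = 0}.
  apply: (IH (fun j => P j.+1)) => j jx; [exact: PP | exact: sP | exact: (xP j.+1)].
rewrite big_allpairs_dep.
have -> : iota 0 M = index_iota 0 M by rewrite /index_iota subn0.
rewrite big_mkord => sumP.
have TP : forall i, (i < M)%N -> T i \in P 1%N.
  have [xP0 xP1] := xP 0%N isT.
  apply: (horner_mem_prime (PP 0%N isT) (PP 1%N isT) (sP 0%N isT) xP0 xP1).
    move=> i /T0 ci; rewrite /T big_seq big1 // => e eM.
    by rewrite ci // rmorph0 mul0r.
  suff -> : \sum_(i < M) x ^+ i * T i = \sum_(i < M) \sum_(e <- exponents (size xs) M)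
      kappa (c (val i :: e)) * power_product (x :: xs) (val i :: e).
    exact: sumP.
  apply: eq_bigr => i _; rewrite mulr_sumr; apply: eq_bigr => e _.
  by rewrite /power_product big_cons /= mulrCA.
move=> _ /allpairsP[[j e] /= [jM eM ->]].
apply: (T0 j _ e eM); apply: TP; by move: jM; rewrite mem_iota add0n subn0.
Qed.

Lemma exists_linear_relation (K : fieldType) (V : eqType) (J : finType) (W : seq V)
    (g : V -> J -> K) : uniq W -> (#|J| < size W)%N ->
  exists2 c : V -> K, exists2 e, e \in W & c e != 0
    & forall j, \sum_(e <- W) c e * g e j = 0.
Proof.
move=> Wu JW.
pose M := \matrix_(i < size W, j < #|J|) g (tnth (in_tuple W) i) (enum_val j).
have : kermx M != 0.
  rewrite -mxrank_eq0 mxrank_ker subn_eq0 -ltnNge.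
  by apply: leq_ltn_trans JW; apply: rank_leq_col.
move=> /rowV0Pn[u /sub_kermxP uM u0].
have [i ui] : exists i, u 0 i != 0.
  apply/existsP; apply: contraNT u0; rewrite negb_exists => /forallP u0.
  by apply/eqP/rowP => i; rewrite mxE; apply/eqP; have := u0 i; rewrite negbK.
(* The kernel row becomes a function on V through positions in [W], with 0 elsewhere; distinctness
   of the entries makes this consistent. *)
pose c e := if insub (index e W) is Some i then u 0 i else 0.
have cE (l : 'I_(size W)) : c (tnth (in_tuple W) l) = u 0 l.
  rewrite /c (tnth_nth (tnth (in_tuple W) l)) index_uniq //.
  by rewrite valK.
exists c.
  by exists (tnth (in_tuple W) i); [apply: mem_tnth | rewrite cE].
move=> j; have := congr1 (fun B : 'rV_#|J| => B 0 (enum_rank j)) uM.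
rewrite !mxE => uMj; rewrite big_tnth -[RHS]uMj; apply: eq_bigr => l _.
by rewrite !mxE enum_rankK cE.
Qed.

End PrimeChains.

Arguments exponents l M : simpl never.

(** * The fiber ring of an ideal of Veronese type *)

Section FiberRing.
Local Open Scope quotient_scope.
Variables (n : nat) (K : fieldType) (d : nat) (a : 'I_n -> nat).
Local Notation S := {mpoly K[n]}.
Local Notation I := (veronese_ideal K n d a).
Local Notation hpart := (pihomog mdeg).
Implicit Types (p q : S) (m v : 'X_{1..n}) (z w : rees I).

Definition order_ge e : {pred S} := mideal (fun m => e <= mdeg m)%N.

Lemma order_ge_is_ideal e : is_ideal (order_ge e).
Proof. by apply: mideal_is_ideal => m k em; rewrite mdegD (leq_trans em) ?leq_addl. Qed.

Lemma order_geM e1 e2 p q :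
  p \in order_ge e1 -> q \in order_ge e2 -> p * q \in order_ge (e1 + e2).
Proof.
move=> /midealP pe /midealP qe; apply/midealP => m /msuppM_le /allpairsP.
by case=> -[m1 m2] /= [/pe m1e /qe m2e ->]; rewrite mdegD leq_add.
Qed.

Lemma sub_hpart_order e p : p \in order_ge e -> p - hpart e p \in order_ge e.+1.
Proof.
move=> /midealP pe; have -> : hpart e p = mpart [pred m | mdeg m == e] p by [].
rewrite sub_mpart; apply/midealP => m; rewrite msupp_mpart /= => /andP[me /pe em].
by rewrite ltn_neqAle eq_sym me.
Qed.

Lemma hpart_order0 e p : p \in order_ge e.+1 -> hpart e p = 0.
Proof.
move=> /midealP pe; have -> : hpart e p = mpart [pred m | mdeg m == e] p by [].
apply/mpolyP => m; rewrite mcoeff_mpart mcoeff0 /=; case: eqP => // me.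
by apply: memN_msupp_eq0; apply/negP => /pe; rewrite me ltnn.
Qed.

(** Every product involving a remainder has order above e1 + e2, so lowest parts multiply. *)
Lemma hpartM e1 e2 p q : p \in order_ge e1 -> q \in order_ge e2 ->
  hpart (e1 + e2) (p * q) = hpart e1 p * hpart e2 q.
Proof.
move=> pe qe; have [_ OD _] := order_ge_is_ideal (e1 + e2).+1.
have h e u : hpart e u \in order_ge e.
  by apply/midealP => m /(dhomog_mf (pihomogP mdeg e u)) /= ->.
set p0 := hpart e1 p; set q0 := hpart e2 q.
have -> : p * q = p0 * q0 + (p0 * (q - q0) + (p - p0) * q) by ring.
rewrite raddfD /= (@hpart_order0 _ (_ + _)) ?addr0.
  by rewrite pihomog_dE // dhomogM // pihomogP.
apply: OD; first by rewrite -addnS; apply: order_geM; rewrite ?sub_hpart_order ?h.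
by rewrite -addSn; apply: order_geM; rewrite ?sub_hpart_order ?h.
Qed.

Lemma rees_coef z k : (rees_val z)`_k \in ideal_exp I k.
Proof. by have /asboolP := valP z; apply. Qed.

Lemma ideal_exp_order k p : p \in ideal_exp I k -> p \in order_ge (k * d).
Proof.
rewrite ideal_exp_veronese => /midealP pT; apply/midealP => m /pT.
by move/leq_trans; apply; rewrite mdegE; apply: leq_sum => i _; apply: geq_minl.
Qed.

(** Elements of I^k have order at least k d, which is what makes taking the degree k d part of each
    coefficient multiplicative. *)
Definition rees_lead z : {poly S} :=
  \poly_(k < size (rees_val z)) hpart (k * d) (rees_val z)`_k.

Lemma coef_rees_lead z k : (rees_lead z)`_k = hpart (k * d) (rees_val z)`_k.
Proof.
rewrite coef_poly; case: ltnP => // zk.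
by rewrite (nth_default _ zk) raddf0.
Qed.

Lemma rees_lead_is_zmod_morphism : zmod_morphism rees_lead.
Proof.
by move=> z w; apply/polyP => k; rewrite coefB !coef_rees_lead -raddfB coefB.
Qed.

Lemma rees_lead_is_monoid_morphism : monoid_morphism rees_lead.
Proof.
split=> [|z w]; apply/polyP => k; rewrite ?coefM coef_rees_lead.
  rewrite !coef1; case: eqP => [->|_]; last by rewrite raddf0.
  by rewrite mul0n pihomog_dE // dhomog1.
rewrite coefM raddf_sum; apply: eq_bigr => i _ /=.
rewrite !coef_rees_lead -hpartM; first by rewrite -mulnDl subnKC // -ltnS.
  exact/ideal_exp_order/rees_coef.
exact/ideal_exp_order/rees_coef.
Qed.

HB.instance Definition _ := GRing.isZmodMorphism.Build (rees I) {poly S}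
  rees_lead rees_lead_is_zmod_morphism.
HB.instance Definition _ := GRing.isMonoidMorphism.Build (rees I) {poly S}
  rees_lead rees_lead_is_monoid_morphism.

(** Setting t = 1 loses nothing when d > 0, for the degree k d of a summand remembers k. *)
Definition fiber_eval : rees I -> S := horner_eval 1 \o rees_lead.

HB.instance Definition _ := GRing.RMorphism.on fiber_eval.

Lemma fiber_evalE z : fiber_eval z =
  \sum_(k < size (rees_val z)) hpart (k * d) (rees_val z)`_k.
Proof.
rewrite /fiber_eval /= /horner_eval /rees_lead horner_poly.
by apply: eq_bigr => i _; rewrite expr1n mulr1.
Qed.

Lemma hpart_fiber_eval z k : (0 < d)%N ->
  hpart (k * d) (fiber_eval z) = hpart (k * d) (rees_val z)`_k.
Proof.
move=> d0; rewrite fiber_evalE raddf_sum /=.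
have [kz|zk] := ltnP k (size (rees_val z)); last first.
  rewrite (nth_default _ zk) raddf0 big1 // => i _.
  apply: (@pihomog_ne0 _ _ _ (i * d)%N); last exact: pihomogP.
  by rewrite eqn_pmul2r // neq_ltn (leq_trans (ltn_ord i) zk).
rewrite (bigD1 (Ordinal kz)) //= pihomog_id big1 ?addr0 // => i ik.
apply: (@pihomog_ne0 _ _ _ (i * d)%N); last exact: pihomogP.
by rewrite eqn_pmul2r.
Qed.

Lemma fiber_ideal_eval z : z \in @fiber_ideal K n I -> fiber_eval z = 0.
Proof.
move=> zF; apply/eqP; move: zF.
apply: (ideal_gen_min (prime_ideal_is_ideal (rmorph_kernel_prime fiber_eval))).
move=> {}z /asboolP[f fm zE].
suff z0 : fiber_eval z = 0 by apply/eqP.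
rewrite fiber_evalE zE big1 // => i _.
rewrite coefC; case: eqP => [->|_]; last by rewrite raddf0.
by rewrite mul0n hpart_order0 //; move: fm; rewrite mem_max_ideal.
Qed.

(** This is p t^k, with the default 0 when that is not in the Rees algebra. *)
Definition rees_monomial k p : rees I := insubd 0 (p *: 'X^k).

Lemma rees_val_monomial k p : p \in ideal_exp I k ->
  rees_val (rees_monomial k p) = p *: 'X^k.
Proof.
move=> pk; rewrite /rees_monomial (val_insubd 0 (p *: 'X^k)) /=.
have -> // : p *: 'X^k \in rees_pred I.
apply/asboolP => j; rewrite coefZ coefXn; case: eqP => [->|_].
  by rewrite mulr1.
by rewrite mulr0; apply: ideal_exp0.
Qed.

(** An exponent above its cap can be lowered without changing the truncated sum. If there is none,
    that sum is the degree, and any positive exponent may be lowered. *)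
Lemma trunc_ge_pred b D m : trunc_ge b D m -> (D < mdeg m)%N ->
  exists i, (0 < m i)%N /\ trunc_ge b D (m - U_(i))%MM.
Proof.
rewrite /trunc_ge => mD Dm.
have [/existsP[i bm]|/existsPn mb] := boolP [exists i, b i < m i]%N.
  exists i; split; first exact: leq_ltn_trans bm.
  apply: leq_trans mD _; apply: leq_sum => j _; rewrite mnmBE mnm1E.
  by case: eqP => [<-|_]; lia.
have /existsP[i mi] : [exists i, 0 < m i]%N.
  apply: contraTT Dm; rewrite negb_exists => /forallP m0.
  rewrite -leqNgt mdegE big1 // => i _; by have := m0 i; lia.
exists i; split=> //.
have im : (U_(i) <= m)%MM by rewrite lep1mP -lt0n.
rewrite (eq_bigr (fun j => (m - U_(i))%MM j)) => [|j _].
  by rewrite -mdegE -ltnS (leq_trans Dm) // -(submK im) mdegD mdeg1 addmK addn1.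
by apply/minn_idPl; rewrite mnmBE; have := mb j; lia.
Qed.

(** If z maps to 0, the coefficient of t^k has no part of degree k d. Each of its monomials then has
    larger degree and is a variable times another monomial of I^k, hence its term lies in m R(I). *)
Lemma fiber_eval_ker z : (0 < d)%N -> fiber_eval z = 0 -> z \in @fiber_ideal K n I.
Proof.
move=> d0 z0.
have zE : z = \sum_(k < size (rees_val z)) \sum_(m <- msupp (rees_val z)`_k)
    rees_monomial k ((rees_val z)`_k@_m *: 'X_[m]).
  apply: val_inj; rewrite rmorph_sum -[LHS]coefK poly_def; apply: eq_bigr => k _.
  rewrite rmorph_sum /= {1}[(rees_val z)`_k]mpolyE scaler_suml.
  rewrite big_seq [RHS]big_seq; apply: eq_bigr => m mz.
  rewrite rees_val_monomial // ideal_exp_veronese.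
  have := rees_coef z k; rewrite ideal_exp_veronese => /midealP/(_ m mz) mT.
  have [_ _ TM] := trunc_ideal_is_ideal K (fun i => k * a i)%N (k * d)%N.
  by rewrite -mul_mpolyC; apply: TM; rewrite mideal_monomial.
rewrite zE; have FI := ideal_gen_is_ideal
  (fun z : rees I => `[< exists2 f : S, f \in max_ideal K n & rees_val z = f%:P >]).
rewrite -big_enum; apply: is_ideal_sum => // k _.
apply: is_ideal_sum => // m mz.
set c := _@__.
have mT : trunc_ge (fun i => k * a i)%N (k * d) m.
  by have := rees_coef z k; rewrite ideal_exp_veronese => /midealP; apply.
have dm : (k * d < mdeg m)%N.
  have := ideal_exp_order (rees_coef z k) => /midealP/(_ m mz).
  rewrite leq_eqVlt => /orP[/eqP dm|//].
  move: mz; rewrite mcoeff_msupp; have := hpart_fiber_eval z k d0.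
  rewrite z0 raddf0 => /(congr1 (mcoeff m)).
  have -> : hpart (k * d) (rees_val z)`_k =
    mpart [pred m | mdeg m == (k * d)%N] (rees_val z)`_k by [].
  by rewrite mcoeff0 mcoeff_mpart /= dm eqxx => <-; rewrite eqxx.
have [i [mi miT]] := trunc_ge_pred mT dm.
have im : (U_(i) <= m)%MM by rewrite lep1mP -lt0n.
have [_ _ TM] := trunc_ideal_is_ideal K (fun i => k * a i)%N (k * d)%N.
have -> : rees_monomial k (c *: 'X_[m]) =
    rees_monomial k (c *: 'X_[m - U_(i)]) * rees_monomial 0%N 'X_i.
  apply: val_inj; rewrite /= [RHS]/= !rees_val_monomial //.
  - rewrite expr0 -scalerAl mulrC -scalerAl mul1r scalerA -{1}(submK im) mpolyXD.
    by rewrite -scalerAl mulrC.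
  - by rewrite ideal_exp_veronese -mul_mpolyC; apply: TM; rewrite mideal_monomial.
  - by rewrite ideal_exp_veronese -mul_mpolyC; apply: TM; rewrite mideal_monomial.
apply/ideal_genM/ideal_gen_sub/asboolP; exists 'X_i.
  by rewrite mem_max_ideal mideal_monomial mdeg1.
by rewrite rees_val_monomial // expr0 alg_polyC.
Qed.

Lemma monomial_in_power k m :
  (forall i, m i <= k * a i)%N -> mdeg m = (k * d)%N ->
  'X_[K, m] \in ideal_exp I k.
Proof.
move=> ma md; rewrite ideal_exp_veronese mideal_monomial /trunc_ge -md mdegE.
by apply: leq_sum => i _; rewrite leq_min leqnn ma.
Qed.

Lemma fiber_eval_monomial k p : p \in ideal_exp I k -> p \is (k * d).-homog ->
  fiber_eval (rees_monomial k p) = p.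
Proof.
move=> pk ph.
have -> : fiber_eval (rees_monomial k p) = (rees_lead (rees_monomial k p)).[1] by [].
have -> : rees_lead (rees_monomial k p) = p *: 'X^k.
  apply/polyP => j; rewrite coef_rees_lead rees_val_monomial // !coefZ !coefXn.
  case: eqP => [->|_]; last by rewrite !mulr0 raddf0.
  by rewrite !mulr1 pihomog_dE.
by rewrite hornerZ hornerXn expr1n mulr1.
Qed.

Definition ones_lt j : S -> S :=
  comp_mpoly [tuple (if (i < j)%N then 1 else 'X_i) | i < n].

Arguments ones_lt j p : simpl never.

HB.instance Definition _ j := GRing.RMorphism.on (ones_lt j).

Lemma ones_ltZ j c p : ones_lt j (c *: p) = c *: ones_lt j p.
Proof. exact: comp_mpolyZ. Qed.

Lemma ones_lt_monomial j m : ones_lt j 'X_[m] =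
  \prod_(i < n) (if (i < j)%N then 1 else 'X_i) ^+ m i.
Proof.
by rewrite /ones_lt comp_mpolyX; apply: eq_bigr => i _; rewrite tnth_mktuple.
Qed.

Lemma ones_ltX j (i : 'I_n) : ones_lt j 'X_i = if (i < j)%N then 1 else 'X_i.
Proof. by rewrite /ones_lt comp_mpolyXU -tnth_nth tnth_mktuple. Qed.

(** This makes the kernels of the successive substitutions increase. *)
Lemma ones_ltS j p : ones_lt j.+1 (ones_lt j p) = ones_lt j.+1 p.
Proof.
rewrite [p]mpolyE (raddf_sum (ones_lt j)) 2!(raddf_sum (ones_lt j.+1)) /=.
apply: eq_bigr => m _.
rewrite !ones_ltZ; congr (_ *: _); rewrite !ones_lt_monomial.
rewrite rmorph_prod; apply: eq_bigr => i _; rewrite rmorphXn /=; congr (_ ^+ _).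
case: ltnP => ij; first by rewrite rmorph1 ltnW.
by rewrite ones_ltX.
Qed.

Lemma ones_lt_monomial_neq0 j m : ones_lt j 'X_[m] != 0.
Proof.
rewrite ones_lt_monomial; apply/prodf_neq0 => i _; apply: expf_neq0.
case: ifP => _; first exact: oner_neq0.
by apply/eqP => /(congr1 (mcoeff U_(i))) /eqP; rewrite mcoeffX mcoeff0 eqxx oner_eq0.
Qed.

(** The kernel of the substitution of 1 for the first j variables, on the fiber ring and tested on
    representatives. *)
Definition fiber_prime j : {pred fiber_ring I} :=
  fun z : {ideal_quot (@fiber_ideal K n I)} =>
    repr z \in (fun z : rees I => ones_lt j (fiber_eval z) == 0).

Lemma fiber_prime_prime j : is_prime_ideal (fiber_prime j).
Proof.
apply: (@prime_ideal_quot _ (@fiber_ideal K n I)).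
  move=> z zF; apply/eqP; rewrite (fiber_ideal_eval zF); exact: rmorph0.
exact: (rmorph_kernel_prime (ones_lt j \o fiber_eval)).
Qed.

Lemma mem_fiber_prime j (z : rees I) :
  (\pi_(fiber_ring I) z \in fiber_prime j) = (ones_lt j (fiber_eval z) == 0).
Proof.
apply: (@repr_pi_ideal _ (@fiber_ideal K n I)
  (fun z : rees I => ones_lt j (fiber_eval z) == 0) z).
  move=> y yF; apply/eqP; rewrite (fiber_ideal_eval yF); exact: rmorph0.
apply: prime_ideal_is_ideal.
exact: (rmorph_kernel_prime (ones_lt j \o fiber_eval)).
Qed.

(* (v, k) is interior to the cone over the polytope sum u = d, 0 <= u <= a, so that
   v + d e_i is still in it. *)
Lemma fiber_prime_strict (i : 'I_n) : (0 < d)%N -> (d < \sum_j a j)%N ->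
  (forall j, 0 < a j)%N -> ~ {subset fiber_prime i.+1 <= fiber_prime i}.
Proof.
move=> d0 da a0 sub.
pose k := (d * \sum_j a j)%N; pose v := [multinom (d * d * a j)%N | j < n].
have vd : mdeg v = (k * d)%N.
  by rewrite mdegE (eq_bigr _ (fun j _ => mnmE _ j)) -big_distrr /= mulnAC.
have va j : (v j <= k * a j)%N.
  by rewrite mnmE -!mulnA leq_mul2l leq_mul2r (ltnW da) !orbT.
pose v' := (v + U_(i) *+ d)%MM.
have v'd : mdeg v' = (k.+1 * d)%N by rewrite mdegD mdegMn mdeg1 vd mul1n mulSn addnC.
have v'a j : (v' j <= k.+1 * a j)%N.
  rewrite mnmDE mulmnE mnm1E; case: eqP => [<-|_]; last first.
    by rewrite mul0n addn0 mulSn (leq_trans (va j)) // leq_addl.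
  rewrite mul1n mulSn mnmE (@leq_trans (d * d.+1 * a i)) //.
    by rewrite mulnS mulnDl addnC leq_add // leq_pmulr.
  by rewrite (@leq_trans (k * a i)) ?leq_addl // -!mulnA leq_mul2l leq_mul2r da !orbT.
have vk := monomial_in_power va vd.
have v'k := monomial_in_power v'a v'd.
(* This element evaluates to x^v (x_i^d - 1), which is killed by setting x_i = 1 but survives when
   only the earlier variables are 1. *)
pose z := rees_monomial k.+1 'X_[v'] - rees_monomial k 'X_[v].
have zE j : ones_lt j (fiber_eval z) =
    ones_lt j 'X_[v] * (ones_lt j 'X_i ^+ d - 1).
  have hv : 'X_[K, v] \is (k * d).-homog by rewrite dhomogX /= vd.
  have hv' : 'X_[K, v'] \is (k.+1 * d).-homog by rewrite dhomogX /= v'd.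
  rewrite !rmorphB /= (fiber_eval_monomial vk hv) (fiber_eval_monomial v'k hv').
  by rewrite mpolyXD -mpolyXn rmorphM rmorphXn mulrBr mulr1.
have := sub (\pi z); rewrite !mem_fiber_prime !zE !ones_ltX ltnSn ltnn.
rewrite expr1n subrr mulr0 eqxx mulf_eq0 (negPf (ones_lt_monomial_neq0 _ _)) /=.
move=> /(_ isT)/eqP/(congr1 (mcoeff 0%MM))/eqP.
rewrite mcoeffB mpolyXn mcoeffX mcoeff1 mcoeff0 eqxx.
rewrite -mdeg_eq0 mdegMn mdeg1 mul1n (gtn_eqF d0) sub0r oppr_eq0.
by rewrite oner_eq0.
Qed.

Definition rees_const (c : K) : rees I := rees_monomial 0 c%:MP.

Lemma rees_val_const c : rees_val (rees_const c) = c%:MP%:P.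
Proof. by rewrite rees_val_monomial // expr0 alg_polyC. Qed.

Lemma rees_const_is_zmod_morphism : zmod_morphism rees_const.
Proof.
move=> c e; apply: val_inj; rewrite rmorphB /= !rees_val_const.
by rewrite !rmorphB.
Qed.

Lemma rees_const_is_monoid_morphism : monoid_morphism rees_const.
Proof.
split=> [|c e]; apply: val_inj; first by rewrite rmorph1 /= rees_val_const !rmorph1.
by rewrite rmorphM /= !rees_val_const !rmorphM.
Qed.

HB.instance Definition _ := GRing.isZmodMorphism.Build K (rees I)
  rees_const rees_const_is_zmod_morphism.
HB.instance Definition _ := GRing.isMonoidMorphism.Build K (rees I)
  rees_const rees_const_is_monoid_morphism.

Lemma fiber_eval_const c : fiber_eval (rees_const c) = c%:MP.
Proof.
apply: fiber_eval_monomial => //; rewrite mul0n.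
by rewrite -[c%:MP]mulr1 mul_mpolyC dhomogZ // dhomog1.
Qed.

Definition deg_le e : {pred S} := mideal (fun m => mdeg m <= e)%N.

Lemma deg_leM e1 e2 p q : p \in deg_le e1 -> q \in deg_le e2 ->
  p * q \in deg_le (e1 + e2).
Proof.
move=> /midealP pe /midealP qe; apply/midealP => m /msuppM_le /allpairsP.
by case=> -[m1 m2] /= [/pe m1e /qe m2e ->]; rewrite mdegD leq_add.
Qed.

Lemma deg_leW e1 e2 p : (e1 <= e2)%N -> p \in deg_le e1 -> p \in deg_le e2.
Proof. by move=> e12 /midealP pe; apply/midealP => m /pe /leq_trans; apply. Qed.

Lemma deg_le1 e : 1 \in deg_le e.
Proof. by rewrite -mpolyX0 mideal_monomial mdeg0. Qed.

Lemma deg_le_power_product (xs : seq (rees I)) C M e :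
  {in xs, forall x, fiber_eval x \in deg_le C} -> size e = size xs ->
  {in e, forall j, j <= M}%N ->
  fiber_eval (power_product xs e) \in deg_le (size xs * (M * C)).
Proof.
elim: xs e => [|x xs IH] [|j e] //= xC.
  by rewrite /power_product big_nil rmorph1 deg_le1.
move=> [ex] eM; rewrite /power_product big_cons /= rmorphM mulSn.
apply: deg_leM; last first.
  apply: IH => // [y yxs|i ie]; first by apply: xC; rewrite inE yxs orbT.
  by apply: eM; rewrite inE ie orbT.
have jM : (j <= M)%N by apply: eM; rewrite inE eqxx.
apply: (@deg_leW (j * C)); first by rewrite leq_mul2r jM orbT.
rewrite rmorphXn; elim: j {eM jM} => [|j IHj]; first by rewrite expr0 deg_le1.
by rewrite exprS mulSn deg_leM // xC // inE eqxx.
Qed.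

Lemma fiber_relation (xs : seq (rees I)) : (0 < d)%N -> size xs = n.+1 ->
  exists M, exists2 c : seq nat -> K,
    exists2 e, e \in exponents n.+1 M & c e != 0
  & \sum_(e <- exponents n.+1 M) rees_const (c e) * power_product xs e
      \in @fiber_ideal K n I.
Proof.
move=> d0 xn; pose C := (\max_(x <- xs) msize (fiber_eval x))%N.
have xC : {in xs, forall x, fiber_eval x \in deg_le C}.
  move=> x xxs; apply/midealP => m /msize_mdeg_lt /ltnW /leq_trans; apply.
  exact: leq_bigmax_seq.
(* The M^(n+1) power products evaluate to polynomials of degree at most T, whose exponents lie in a
   box of (T + 1)^n points. As T + 1 <= M Q and Q^n < M, there are more products than points, which
   forces a nontrivial linear relation. *)
pose Q := (n.+1 * C).+1; pose M := (Q ^ n).+1; pose T := (n.+1 * (M * C))%N.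
have TM : (T.+1 ^ n < M ^ n.+1)%N.
  have TQ : (T.+1 <= M * Q)%N by rewrite /T /Q; lia.
  apply: (@leq_ltn_trans ((M * Q) ^ n)); last first.
    by rewrite expnMn expnSr ltn_pmul2l ?expn_gt0.
  by case: {+}(n) => // l; rewrite leq_exp2r.
pose g (e : seq nat) (f : {ffun 'I_n -> 'I_T.+1}) :=
  (fiber_eval (power_product xs e))@_[multinom (f i : nat) | i < n].
have [|c ce cg] := exists_linear_relation g (exponents_uniq n.+1 M).
  by rewrite size_exponents card_ffun !card_ord.
exists M, c => //; apply: fiber_eval_ker => //.
rewrite rmorph_sum /=; apply/mpolyP => m; rewrite mcoeff0 raddf_sum /=.
under eq_bigr do rewrite rmorphM /= fiber_eval_const mcoeffCM.
have [mT|mT] := leqP (mdeg m) T.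
  have mi (i : 'I_n) : (m i < T.+1)%N.
    by rewrite ltnS (leq_trans _ mT) // mdegE (bigD1 i) //= leq_addr.
  rewrite -[RHS](cg [ffun i => Ordinal (mi i)]); apply: eq_bigr => e _.
  congr (_ * _@__); apply/mnmP => i; by rewrite mnmE ffunE.
rewrite big_seq big1 // => e /exponentsP[en eM].
rewrite memN_msupp_eq0 ?mulr0 //; apply/negP => me.
have /midealP/(_ m me) : fiber_eval (power_product xs e) \in deg_le T.
  rewrite /T -xn; apply: deg_le_power_product => //; first by rewrite en.
  by move=> j /eM /ltnW.
by rewrite leqNgt mT.
Qed.

Lemma analytic_spread_veronese : (0 < d)%N -> (d < \sum_j a j)%N ->
  (forall j, 0 < a j)%N -> is_analytic_spread I n.
Proof.
move=> d0 da a0; split.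
  exists fiber_prime; split=> [i _|i iltn]; first exact: fiber_prime_prime.
  split; last exact: (fiber_prime_strict (i := Ordinal iltn)).
  move=> z; rewrite !unfold_in => /eqP z0.
  by rewrite -ones_ltS z0 rmorph0.
move=> c k [cP cS]; rewrite leqNgt; apply/negP => nk.
pose P i : {pred rees I} := fun z => \pi_(fiber_ring I) z \in c i.
(* A chain with more than n steps supplies x_i in P_(i+1) but not in P_i. The first n + 1 of them
   have independent power products modulo P_0, against the relation that any n + 1 elements satisfy
   in the fiber ring. *)
have /boolp.choice[x xP] : forall i, exists x : rees I, (i < k)%N ->
    x \notin P i /\ x \in P i.+1.
  move=> i; have [ik|ik] := ltnP i k; last by exists 0.
  have [_ nsub] := cS i ik.
  apply: contrapT => nx; apply: nsub => y yc; apply: contrapT => /negP yn.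
  apply: nx; exists (repr y) => _; rewrite /P !unfold_in reprK.
  by split.
have [M [e [e0 e0W ce0] eF]] := fiber_relation d0 (size_mkseq x n.+1).
have : {in exponents n.+1 M, forall f, e f = 0}.
  rewrite -(size_mkseq x n.+1).
  apply: (@chain_power_products_free _ _ rees_const P); rewrite ?size_mkseq.
  - move=> i iltn; apply: (@prime_ideal_pi _ (@fiber_ideal K n I)).
    by apply: cP; lia.
  - move=> i iltn z zP; have [ci _] := cS i (leq_trans iltn nk).
    exact: ci.
  - by move=> i iltn; rewrite nth_mkseq //; apply: xP; lia.
  have [[c0 _ _] _] := cP 0%N isT.
  have F0 z : z \in @fiber_ideal K n I -> \pi_(fiber_ring I) z = 0.
    move=> zF; rewrite -(rmorph0 (\pi_(fiber_ring I))).
    by apply/eqP; rewrite -Quotient.idealrBE subr0.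
  by rewrite unfold_in F0.
by move=> /(_ e0 e0W) /eqP; rewrite (negPf ce0).
Qed.

End FiberRing.

(** * Stability indices *)

Lemma is_depth_unique (R : comNzRingType) (M J : {pred R}) r r' :
  is_depth M J r -> is_depth M J r' -> r = r'.
Proof.
move=> [[s [sr sM sJ]] rmax] [[s' [s'r s'M s'J]] r'max].
by apply/eqP; rewrite eqn_leq -{1}sr -{2}s'r rmax ?r'max.
Qed.

(** * Depth, associated primes and stability of the powers *)

Section VeronesePowers.
Variables (n : nat) (K : fieldType) (d : nat) (a : 'I_n -> nat).
Local Notation I := (veronese_ideal K n d a).
Local Notation m := (max_ideal K n).

Hypotheses (da : (d < \sum_i a i)%N) (d0 : (0 < d)%N) (a0 : forall i, (0 < a i)%N).

Local Notation gap := (\sum_i a i - d)%N.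

Let gap0 : (0 < gap)%N. Proof. by rewrite subn_gt0. Qed.

Let n0 : (0 < n)%N.
Proof.
rewrite lt0n; apply: contraTneq da => n0; rewrite -leqNgt big1 // => i.
by have := ltn_ord i; rewrite [X in (_ < X)%N]n0.
Qed.

Let sum_mul k : (\sum_i k * a i = k * \sum_i a i)%N.
Proof. by rewrite big_distrr. Qed.

(** The slack sum b - D is now k times [gap], and truncated subtraction supplies the maximum with
    0. *)
Lemma depth_veronese_power k : (0 < k)%N ->
  is_depth m (ideal_exp I k) (n - (k * gap).+1).
Proof.
move=> k0.
have -> : ideal_exp I k = trunc_ideal K (fun i => k * a i)%N (k * d).
  by apply: boolp.funext => p; apply: ideal_exp_veronese.
rewrite mulnBr -sum_mul; apply: depth_trunc_ideal => //.
- by move=> i; rewrite muln_gt0 k0 a0.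
- by rewrite muln_gt0 k0.
- by rewrite sum_mul leq_mul2l ltnW ?orbT.
Qed.

(** The factor k cancels in the condition off [A], so only the bound on |A| depends on k, and the
    sets of associated primes increase. *)
Lemma assoc_prime_veronese_power k P : (0 < k)%N ->
  is_assoc_prime (ideal_exp I k) P <->
  exists A, [/\ P =i face_ideal K A, (\sum_(i | i \notin A) a i < d)%N
    & (#|A| <= (k * gap).+1)%N].
Proof.
move=> k0.
have -> : ideal_exp I k = trunc_ideal K (fun i => k * a i)%N (k * d).
  by apply: boolp.funext => p; apply: ideal_exp_veronese.
rewrite assoc_prime_trunc_ideal; first last.
- by rewrite sum_mul leq_mul2l ltnW ?orbT.
- by move=> i; rewrite muln_gt0 k0 a0.
have H A : ((\sum_(i | i \notin A) k * a i < k * d) =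
    (\sum_(i | i \notin A) a i < d))%N.
  by rewrite -big_distrr ltn_pmul2l.
have H' A : (#|A : {set 'I_n}| + k * d <= (\sum_i k * a i).+1)%N =
    (#|A| <= (k * gap).+1)%N.
  have : (k * d <= k * \sum_i a i)%N by rewrite leq_mul2l (ltnW da) orbT.
  rewrite sum_mul mulnBr; move: (k * d)%N (k * _)%N #|A| => x y z; lia.
split=> -[A [PA sA cA]]; exists A; split=> //.
- by rewrite -H.
- by rewrite -H'.
- by rewrite H.
- by rewrite H'.
Qed.

Section Stability.
Variable s : nat.
Hypotheses (s0 : (0 < s)%N) (ns : (n.-1 <= s * gap)%N).
Hypothesis s_min : forall k, (0 < k)%N -> (n.-1 <= k * gap)%N -> (s <= k)%N.

(** From [s] on, the depth is 0 and the bound on |A| holds for every set of variables. *)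
Let stable k : (s <= k)%N -> (n <= (k * gap).+1)%N.
Proof.
move=> sk; apply: leq_trans (leqSpred n) _; rewrite ltnS (leq_trans ns) //.
by rewrite leq_mul2r sk orbT.
Qed.

(** For minimality, the depth at k0 is compared with the depth at max(k0, s), which is 0. *)
Lemma veronese_is_dstab : is_dstab m I s.
Proof.
split=> [|k0 [k00 H]].
  split=> // k sk; exists 0%N; split.
    have := depth_veronese_power (leq_trans s0 sk).
    by have -> : (n - (k * gap).+1 = 0)%N by apply/eqP/stable.
  have := depth_veronese_power s0.
  by have -> : (n - (s * gap).+1 = 0)%N by apply/eqP/stable.
have [r [rmax rk0]] := H (maxn k0 s) (leq_maxl _ _).
apply: s_min => //.
have r0 : r = 0%N.
  have sm : (0 < maxn k0 s)%N by rewrite leq_max k00.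
  rewrite (is_depth_unique rmax (depth_veronese_power sm)).
  by apply/eqP/stable/leq_maxr.
have := is_depth_unique rk0 (depth_veronese_power k00).
by rewrite r0 => /esym/eqP; rewrite subn_eq0 -subn1 leq_subLR add1n.
Qed.

(** For minimality, the maximal ideal is associated to the power max(k0, s), hence to the power k0,
    and its n variables force n - 1 <= k0 gap. *)
Lemma veronese_is_astab : is_astab I s.
Proof.
split=> [|k0 [k00 H]].
  split=> // k sk P.
  rewrite !assoc_prime_veronese_power //; last exact: leq_trans sk.
  have cA (A : {set 'I_n}) j : (s <= j)%N -> (#|A| <= (j * gap).+1)%N.
    move=> sj; apply: leq_trans (stable sj); rewrite -[leqRHS]card_ord.
    exact: max_card.
  by split=> -[A [PA sA _]]; exists A; split=> //; apply: cA.
have := (H (maxn k0 s) (leq_maxl _ _) (face_ideal K finset.setT)).1.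
rewrite !assoc_prime_veronese_power // ?leq_max ?k00 //.
case.
  exists finset.setT; split=> //; first by rewrite big_pred0 // => i; rewrite inE.
  by rewrite cardsT card_ord stable // leq_maxr.
move=> A [TA _ cA]; apply: s_min => //.
have AT : A = finset.setT.
  by apply/finset.setP => i; rewrite -(mem_face_ideal_X K) -TA mem_face_ideal_X.
by move: cA; rewrite AT cardsT card_ord -subn1 leq_subLR add1n.
Qed.

End Stability.

Lemma exists_stability_index : exists s, [/\ (0 < s)%N, (n.-1 <= s * gap)%N
  & forall k, (0 < k)%N -> (n.-1 <= k * gap)%N -> (s <= k)%N].
Proof.
have ex : exists k, (0 < k)%N && (n.-1 <= k * gap)%N.
  by exists n; rewrite n0 (leq_trans (leq_pred n)) // leq_pmulr.
case: (ex_minnP ex) => s /andP[s0 ns] s_min; exists s; split=> // k k0 nk.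
by apply: s_min; rewrite k0.
Qed.

End VeronesePowers.

Theorem corollary4p7 (K : fieldType) (n d : nat) (a : 'I_n -> nat) :
  (d < \sum_i a i)%N -> (1 < d)%N -> (forall i, (1 <= a i)%N) ->
  let m := max_ideal K n in
  let I := veronese_ideal K n d a in
  (* (a) *)
  (exists2 r : nat, is_depth m I r
     & r%:Z = Num.max 0 (d%:Z + n%:Z - 1 - \sum_i (a i)%:Z)) /\
  (* (b) *)
  (forall k : nat, (0 < k)%N ->
     exists2 r : nat, is_depth m (ideal_exp I k) r
       & r%:Z = Num.max 0 (k%:Z * d%:Z + n%:Z - 1 - \sum_i k%:Z * (a i)%:Z)) /\
  (* (c); if n = 1, the ceiling is 0 whereas dstab(I) = 1 *)
  ((1 < n)%N -> exists2 s : nat, is_dstab m I s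
     & s%:Z = Num.ceil ((n%:R - 1) / (\sum_i (a i)%:R - d%:R) : rat)) /\
  (* astab(I) = dstab(I) *)
  (exists2 s : nat, is_dstab m I s & is_astab I s) /\
  (* lim depth S/I^k = 0 *)
  (exists2 u : nat -> nat,
     forall k, (0 < k)%N -> is_depth m (ideal_exp I k) (u k)
     & u k @[k --> \oo] --> 0%N) /\
  (* l(I) = n *)
  is_analytic_spread I n.
Proof.
move=> da d1 a0 m I; have d0 := ltnW d1.
have sumZ : \sum_i (a i)%:Z = (\sum_i a i)%N%:Z.
  by rewrite (big_morph Posz PoszD (erefl _)).
have [s [s0 ns s_min]] := exists_stability_index da.
have ds := veronese_is_dstab K da d0 a0 s0 ns s_min.
split; [|split; [|split; [|split; [|split]]]].
(* The case k = 1 of the power formula, as I = I^1. *)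
- exists (n - (1 * (\sum_i a i - d)).+1)%N.
    have -> : I = ideal_exp I 1%N.
      apply: boolp.funext => p; suff : (p \in I) = (p \in ideal_exp I 1%N) by [].
      rewrite ideal_exp_veronese veronese_idealE mul1n.
      by apply: eq_trunc_ideal => i; rewrite mul1n.
    exact: depth_veronese_power.
  rewrite sumZ mul1n; lia.
- move=> k k0; exists (n - (k * (\sum_i a i - d)).+1)%N.
    exact: depth_veronese_power.
  have kda : (k * d <= k * \sum_i a i)%N by rewrite leq_mul2l (ltnW da) orbT.
  rewrite -mulr_sumr sumZ mulnBr -!PoszM; lia.
- move=> n1; exists s => //; apply/esym.
  have gap0 : (0 < \sum_i a i - d)%N by rewrite subn_gt0.
  rewrite -natr_sum -(natrB _ (ltnW da)) -(natrB _ (ltnW n1)) subn1.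
  apply: ceil_def; rewrite ltr_pdivlMr ?ler_pdivrMr ?ltr0n //.
  rewrite -[1 : int]/(1%N%:Z) subzn // !pmulrn -!intrM -!PoszM !ltr_int !ler_int.
  rewrite ltz_nat lez_nat ns andbT subn1 ltnNge; apply/negP => ns'.
  (* Minimality speaks of positive integers only; for s = 1 the strict lower bound is n > 1. *)
  have [s1|s1] := posnP s.-1; first by rewrite s1 mul0n in ns'; lia.
  by have := s_min _ s1 ns'; lia.
- by exists s => //; apply: veronese_is_astab.
- exists (fun k => n - (k * (\sum_i a i - d)).+1)%N.
    by move=> k k0; apply: depth_veronese_power.
  (* For k >= n the depth is already 0, since the gap is at least 1. *)
  apply: cvg_near_cst; exists n => // k /= nk; apply/eqP; rewrite subn_eq0 ltnW //.
  by rewrite ltnS (leq_trans nk) // leq_pmulr // subn_gt0.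
- exact: analytic_spread_veronese.
Qed.
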